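(* Let $A$ be a sufficiently generic $d\times n$ tropical matrix such that $\mathcal{H}=\mathcal{H}(A)$ is a graphic tropical hyperplane arrangement whose underlying graph $\mathcal{G}=\mathcal{G}(A)$ is connected. Then the number of (minimal) generators of the fine type ideal $I_{T(\mathcal{H})}$, as well as of the coarse type ideal $I_{\mathbf{t}(\mathcal{H})}$, is the number of forests in $\mathcal{G}$. The rank of the highest syzygy module of both $I_{T(\mathcal{H})}$ and $I_{\mathbf{t}(\mathcal{H})}$ is the number of spanning trees of $\mathcal{G}$.
   Context: A $d\times n$ tropical matrix is a matrix $A=(a_{ik})$ with entries in $\mathbb{R}\cup\{\infty\}$ such that every column has at least one finite entry. The arrangement $\mathcal{H}(A)$ of max-tropical hyperplanes with apices the columns $\mathbf{a}_k$ of $A$ is graphic if every column of $A$ has exactly two finite entries. Then $\mathcal{G}(A)$ is the graph (possibly with multiple edges) on vertex set $[d]$ with one edge $\{i,j\}$ for each column, where $i,j$ are the rows of its finite entries. Forests are acyclic edge subsets of $\mathcal{G}$ (including the empty one). Let $\mathbb{1}\in\mathbb{R}^d$ be the all-ones vector. The $i$-th closed sector of the $k$-th hyperplane is $S_i(\mathbf{a}_k)=\{\mathbf{p}\in\mathbb{R}^d/\mathbb{R}\mathbb{1}: p_i-a_{ik}\ge p_j-a_{jk}\ \forall j\in[d]\}$ (with $p_j-\infty=-\infty$). The fine type of $\mathbf{p}$ is $T(\mathbf{p})\in\{0,1\}^{d\times n}$ with $T(\mathbf{p})_{ik}=1$ iff $a_{ik}$ is finite and $\mathbf{p}\in S_i(\mathbf{a}_k)$;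 the coarse type $\mathbf{t}(\mathbf{p})\in\mathbb{N}^d$ is the vector of row sums of $T(\mathbf{p})$. For a field $\Bbbk$, $I_{T(\mathcal{H})}=\langle\prod_{T(\mathbf{p})_{ij}=1}x_{ij}:\mathbf{p}\in\mathbb{R}^d/\mathbb{R}\mathbb{1}\rangle\subseteq\Bbbk[x_{ij}:a_{ij}\text{ finite}]$ and $I_{\mathbf{t}(\mathcal{H})}=\langle x_1^{t_1}\cdots x_d^{t_d}:\mathbf{t}=\mathbf{t}(\mathbf{p}),\ \mathbf{p}\in\mathbb{R}^d/\mathbb{R}\mathbb{1}\rangle\subseteq\Bbbk[x_1,\dots,x_d]$. The highest syzygy module is the last nonzero free module in the minimal free resolution of the ideal. $A$ is sufficiently generic if the regular subdivision of $Q=\mathrm{conv}\{\mathbf{e}_i-\mathbf{e}_{\bar j}:a_{ij}\text{ finite}\}\subset\mathbb{R}^{d+n}$ obtained by lifting $\mathbf{e}_i-\mathbf{e}_{\bar j}$ to height $a_{ij}$ and projecting the lower faces is a triangulation. *)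

(* Defs.v *)
From HB Require Import structures.
From mathcomp Require Import all_boot all_order all_algebra.
From mathcomp Require Import reals.
From mathcomp Require Import mpoly.

Set Implicit Arguments.
Unset Strict Implicit.
Unset Printing Implicit Defensive.

Import Order.TTheory GRing.Theory Num.Theory.
Local Open Scope ring_scope.

(* A multigraph on 'I_d with edges 'I_n is given by the set of endpoints of
   each edge; distinct edges may have the same endpoints (parallel edges). *)
Section Multigraph.
Variables (d n : nat).
Implicit Types (G : 'I_n -> {set 'I_d}) (F : {set 'I_n}).

Definition adjacent G F : rel 'I_d :=
  fun i j => [exists k in F, G k == [set i; j]].

(* Nonempty, so that a connected graph has at least one vertex. *)
Definition connected_by G F : bool :=
  (0 < d)%N && [forall i, forall j, connect (adjacent G F) i j].

Definition connected_graph G : bool := connected_by G setT.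

(* A cycle is a nonempty cyclic list of pairs (vertex, edge leaving towards
   the next vertex) with pairwise distinct vertices and pairwise distinct
   edges; two parallel edges form a cycle of length 2. *)
Definition is_cycle G (c : seq ('I_d * 'I_n)) : bool :=
  [&& cycle (fun x y => G x.2 == [set x.1; y.1]) c,
      uniq (map fst c) & uniq (map snd c)].

(* The length m.+1 of a cycle is at most d since its vertices are distinct. *)
Definition acyclic G F : bool :=
  ~~ [exists m : 'I_d, exists c : m.+1.-tuple ('I_d * 'I_n),
        is_cycle G c && all (fun x => x.2 \in F) c].

Definition forests G : {set {set 'I_n}} := [set F | acyclic G F].

Definition spanning_trees G : {set {set 'I_n}} :=
  [set F | acyclic G F && connected_by G F].

End Multigraph.

Section Polytopes.
Variable R : realType.

Definition conv (I : finType) (m : nat) (P : pred I) (v : I -> 'rV[R]_m)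
    (x : 'rV[R]_m) : Prop :=
  exists w : I -> R,
    [/\ forall i, 0 <= w i, forall i, ~~ P i -> w i = 0, \sum_i w i = 1
      & x = \sum_i w i *: v i].

Definition affinely_independent (m r : nat) (v : 'I_r -> 'rV[R]_m) : Prop :=
  forall c : 'I_r -> R,
    \sum_i c i = 0 -> \sum_i c i *: v i = 0 -> forall i, c i = 0.

Definition is_simplex (m : nat) (X : 'rV[R]_m -> Prop) : Prop :=
  exists (r : nat) (v : 'I_r -> 'rV[R]_m),
    affinely_independent v /\ forall x, X x <-> conv predT v x.

End Polytopes.

(* Entries in R together with oo, where None stands for oo. *)
Section Tropical.
Variables (R : realType) (d n : nat).
Implicit Type A : 'M[option R]_(d, n).

Definition tropical_matrix A : Prop := forall k, exists i, isSome (A i k).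

Definition col_support A (k : 'I_n) : {set 'I_d} := [set i | isSome (A i k)].

Definition graphic A : Prop := forall k, #|col_support A k| = 2%N.

Definition finite_entries A : {set 'I_d * 'I_n} :=
  [set e | isSome (A e.1 e.2)].

(* e_i - e_{bar k} in R^(d + n). *)
Definition root_point (e : 'I_d * 'I_n) : 'rV[R]_(d + n) :=
  row_mx (delta_mx 0 e.1) (- delta_mx 0 e.2).

(* Only used at finite entries. *)
Definition lifted_point A (e : 'I_d * 'I_n) : 'rV[R]_(d + n + 1) :=
  row_mx (root_point e) (odflt 0 (A e.1 e.2))%:M.

Definition lifted_polytope A : 'rV[R]_(d + n + 1) -> Prop :=
  conv (mem (finite_entries A)) (lifted_point A).

Definition face_of (m : nat) (X : 'rV[R]_m -> Prop) (f : 'cV[R]_m) :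
    'rV[R]_m -> Prop :=
  fun z => X z /\ forall y, X y -> (z *m f) 0 0 <= (y *m f) 0 0.

Definition regular_cell A (f : 'cV[R]_(d + n + 1)) : 'rV[R]_(d + n) -> Prop :=
  fun x => exists2 z, face_of (lifted_polytope A) f z & x = lsubmx z.

(* The lower faces are those minimising a functional whose coefficient on the
   height coordinate is positive. *)
Definition sufficiently_generic A : Prop :=
  forall f : 'cV[R]_(d + n + 1),
    0 < f (rshift (d + n) 0) 0 -> is_simplex (regular_cell A f).

(* Points of R^d / R 1 are given by representatives in R^d: membership in a
   sector is invariant under adding a multiple of the all-ones vector.
   The inequality p_i - a_ik >= p_j - a_jk is read with p - oo = -oo. *)
Definition closed_sector A (i : 'I_d) (k : 'I_n) (p : 'rV[R]_d) : bool :=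
  [forall j, match A j k, A i k with
             | None, _ => true
             | Some _, None => false
             | Some b, Some a => p 0 j - b <= p 0 i - a
             end].

Definition fine_type A (p : 'rV[R]_d) : 'M[bool]_(d, n) :=
  \matrix_(i, k) (isSome (A i k) && closed_sector A i k p).

Definition coarse_type A (p : 'rV[R]_d) : 'X_{1..d} :=
  [multinom (\sum_k fine_type A p i k)%N | i < d].

(* Exponent vector of the product of the x_ik with T(p)_ik = 1; the variables
   x_ik are indexed by the enumeration of the finite entries. *)
Definition fine_type_mnm A (p : 'rV[R]_d) : 'X_{1..#|finite_entries A|} :=
  [multinom (fine_type A p (enum_val v).1 (enum_val v).2 : nat)
     | v < #|finite_entries A|].

End Tropical.

Section Ideals.
Variables (K : fieldType) (N : nat).
Implicit Types (I : {mpoly K[N]} -> Prop) (M : 'X_{1..N} -> Prop).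

Definition monomial_ideal M : {mpoly K[N]} -> Prop :=
  fun p => exists s : seq ({mpoly K[N]} * 'X_{1..N}),
    (forall x, x \in s -> M x.2) /\ p = \sum_(x <- s) x.1 * 'X_[x.2].

Definition generates (G : seq 'X_{1..N}) I : Prop :=
  forall p, I p <-> monomial_ideal (fun m => m \in G) p.

Definition minimal_generators (G : seq 'X_{1..N}) I : Prop :=
  [/\ uniq G, generates G I & forall m, m \in G -> ~ generates (rem m G) I].

Definition number_of_minimal_generators I (r : nat) : Prop :=
  (exists G, minimal_generators G I) /\
  forall G, minimal_generators G I -> size G = r.

(* Free modules S^r over S = K[x_1..x_N] are modules of row vectors, and maps
   act by right multiplication: ... -> S^(rk 1) -> S^(rk 0) -> S. *)
Record complex := Complex {
  rk : nat -> nat;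
  aug : 'M[{mpoly K[N]}]_(rk 0, 1);
  dif : forall i, 'M[{mpoly K[N]}]_(rk i.+1, rk i)
}.

Definition resolves (C : complex) I : Prop :=
  [/\ forall p, I p <-> exists v : 'rV_(rk C 0), p = (v *m aug C) 0 0,
      forall v : 'rV_(rk C 0), v *m aug C = 0 <-> exists w, v = w *m dif C 0
    & forall i (v : 'rV_(rk C i.+1)),
        v *m dif C i = 0 <-> exists w, v = w *m dif C i.+1].

(* Maps are homogeneous of degree 0 for the standard grading, the r-th basis
   vector of the i-th module being in degree deg i r. *)
Definition graded (C : complex) : Prop :=
  exists deg : forall i, 'I_(rk C i) -> nat,
    (forall r, aug C r 0 \is (deg 0%N r).-homog) /\
    forall i r c,
      ((deg i c <= deg i.+1 r)%N ->
         dif C i r c \is (deg i.+1 r - deg i c)%N.-homog) /\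
      ((deg i.+1 r < deg i c)%N -> dif C i r c = 0).

Definition minimal (C : complex) : Prop :=
  forall i r c, (dif C i r c)@_0%MM = 0.

Definition minimal_free_resolution (C : complex) I : Prop :=
  [/\ resolves C I, graded C & minimal C].

Definition last_nonzero_rank (C : complex) (r : nat) : Prop :=
  exists L, [/\ (0 < rk C L)%N, forall i, (L < i)%N -> rk C i = 0%N
              & rk C L = r].

(* Existence is included so that the second clause is not vacuous. *)
Definition highest_syzygy_rank I (r : nat) : Prop :=
  (exists C, minimal_free_resolution C I) /\
  forall C, minimal_free_resolution C I -> last_nonzero_rank C r.

End Ideals.

Section TypeIdeals.
Variables (K : fieldType) (R : realType) (d n : nat).
Implicit Type A : 'M[option R]_(d, n).

Definition fine_type_ideal A : {mpoly K[#|finite_entries A|]} -> Prop :=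
  monomial_ideal (fun m => exists p, m = fine_type_mnm A p).

Definition coarse_type_ideal A : {mpoly K[d]} -> Prop :=
  monomial_ideal (fun m => exists p, m = coarse_type A p).

End TypeIdeals.

Arguments fine_type_ideal K {R d n} A _.
Arguments coarse_type_ideal K {R d n} A _.

(* Main.v *)
Require Import Defs.
From mathcomp Require Import all_boot all_order all_algebra.
From mathcomp Require Import boolp reals.
From mathcomp Require Import mpoly.
From mathcomp Require Import ring lra zify.

(** A column k of A with finite entries in rows i and j is the affine hyperplane
p_i - p_j = a_ik - a_jk, so the type of p is the same thing as its sign vector:
for each k, on which side of that hyperplane p lies, or that p is on it.  Both
type ideals are generated by labels of sign vectors, the label of an edge being
one variable when p is on a side and the product of both variables when p is on
the hyperplane.

Two properties of the set L of sign vectors of points carry the algebra.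
Refinement: a zero sign can be changed to either sign.  This is where
genericity enters: an affine dependency in a cell of the subdivision is
obtained from a cycle of hyperplanes through a point, so the zero set of a sign
vector is a forest ([generic_acyclic]), and in a forest each edge can be moved
alone, by the indicator function of one side of its cut ([cut_edge]).
Elimination: if two sign vectors are on different sides of e, some sign vector
that is zero at e agrees with both where they agree, and its label divides the
least common multiple of their labels.  It is the sign vector of the point
where the tropical segment between the two points meets the hyperplane
([tropical_segment]).  Tropical convexity is what makes one argument work
for the fine and for the coarse labels ([covectors_family]).

Decide the edges one at a time.  If the next edge has variables x and y, the
ideal of the sign vectors that are still possible is x I+ + y I-, where I+, I-
and I0 are the ideals of its three slices, and by elimination the intersection
of x I+ and y I- is x y I0.  Hence a mapping cone of the resolution of I0 into
those of I+ and I- resolves the ideal.  All these resolutions are linear, and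
the comparison maps acquire a factor x or y, so the cone is again linear and in
particular minimal.  Its i-th module has one basis vector for each sign vector
with i zeros ([family_resolution]).  Minimal resolutions have unique ranks
([minimal_rank_unique]), so the last nonzero rank is the number of sign vectors
with d - 1 zeros.  These are the points lying on the hyperplanes of a spanning
tree, one for each tree ([card_vertices]).

The minimal generators are the labels of the sign vectors without zeros: they
all have degree n, and two with equal labels coincide because elimination would
otherwise produce a divisor of larger degree ([total_chamber_inj]).  The same
induction over the edges shows that there are as many of them as sets of
hyperplanes with a common point ([card_chambers]), and these sets are the
forests ([forestsE]). *)

Set Implicit Arguments.
Unset Strict Implicit.
Unset Printing Implicit Defensive.

Import Order.TTheory GRing.Theory Num.Theory.
Local Open Scope ring_scope.

(** * Comparison of resolutions *)

(** Each map of a chain map or of a homotopy is chosen from the previous one;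
    P is the solvability condition that the choice has to preserve. *)
Lemma dependent_chain (T : nat -> Type) (P : forall i, T i -> Prop)
    (Q : forall i, T i -> T i.+1 -> Prop) (x0 : T 0) :
  P 0 x0 ->
  (forall i x, P i x -> exists y, Q i x y /\ P i.+1 y) ->
  exists f : forall i, T i, f 0 = x0 /\ forall i, Q i (f i) (f i.+1).
Proof.
move=> P0 step.
pose next i (x : {x : T i | P i x}) :=
  cid (step i (sval x) (svalP x)).
pose g := fix g i : {x : T i | P i x} :=
  match i with
  | 0 => exist (P 0) x0 P0
  | j.+1 => exist (P j.+1) (sval (next j (g j))) (proj2 (svalP (next j (g j))))
  end.
exists (fun i => sval (g i)); split=> // i.
exact: proj1 (svalP (next i (g i))).
Qed.

Lemma image_mx (R : pzRingType) (l m n : nat) (D : 'M[R]_(m, n))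
    (V : 'M[R]_(l, n)) :
  (forall i, exists w, row i V = w *m D) -> exists W, V = W *m D.
Proof.
move=> /fin_all_exists [w Hw]; exists (\matrix_i w i).
by apply/row_matrixP => i; rewrite row_mul rowK.
Qed.

Lemma exact_mx (R : pzRingType) (l m n p : nat) (D : 'M[R]_(m, n))
    (E : 'M[R]_(p, m)) :
  (forall v : 'rV_m, v *m D = 0 -> exists w, v = w *m E) ->
  forall V : 'M_(l, m), V *m D = 0 -> exists W, V = W *m E.
Proof.
move=> ex V VD; apply: image_mx => i; apply: ex.
by rewrite -row_mul VD row0.
Qed.

Section Resolutions.
Variables (K : fieldType) (N : nat).
Local Notation S := {mpoly K[N]}.
Implicit Types (I J : S -> Prop) (C : complex K N).

Lemma resolves_aug C I : resolves C I -> forall r, I (aug C r 0).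
Proof.
case=> H _ _ r; apply/H; exists (delta_mx 0 r).
by rewrite -rowE mxE.
Qed.

Lemma resolves_difaug C I : resolves C I -> dif C 0 *m aug C = 0.
Proof.
case=> _ H _; apply/row_matrixP => i; rewrite row0 row_mul.
by apply/H; exists (delta_mx 0 i); rewrite rowE.
Qed.

Lemma resolves_difdif C I i : resolves C I -> dif C i.+1 *m dif C i = 0.
Proof.
case=> _ _ H; apply/row_matrixP => j; rewrite row0 row_mul.
by apply/H; exists (delta_mx 0 j); rewrite rowE.
Qed.

Lemma resolves_exact0 C I l (V : 'M_(l, rk C 0)) : resolves C I ->
  V *m aug C = 0 -> exists W, V = W *m dif C 0.
Proof. by case=> _ H _; apply: exact_mx => v /H. Qed.

Lemma resolves_exactS C I i l (V : 'M_(l, rk C i.+1)) : resolves C I ->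
  V *m dif C i = 0 -> exists W, V = W *m dif C i.+1.
Proof. by case=> _ _ H; apply: exact_mx => v /H. Qed.

Lemma comparison_map C C' I J : resolves C I -> resolves C' J ->
  (forall p, I p -> J p) ->
  exists f : forall i, 'M[S]_(rk C i, rk C' i),
    aug C = f 0%N *m aug C' /\
    forall i, dif C i *m f i = f i.+1 *m dif C' i.
Proof.
move=> resC resC' subIJ.
have [f0 f0E] : exists f0, aug C = f0 *m aug C'.
  apply: image_mx => i; have [/(_ (aug C i 0)) H _ _] := resC'.
  have [w wE] := H.1 (subIJ _ (resolves_aug resC i)).
  by exists w; apply/matrixP => a b; rewrite !ord1 mxE.
pose P i (f : 'M[S]_(rk C i, rk C' i)) :=
  exists g, dif C i *m f = g *m dif C' i.
have P0 : P 0%N f0.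
  apply: (resolves_exact0 resC').
  by rewrite -mulmxA -f0E (resolves_difaug resC).
have step i f : P i f -> exists g, dif C i *m f = g *m dif C' i /\ P i.+1 g.
  case=> g gE; exists g; split=> //.
  apply: (resolves_exactS resC').
  by rewrite -mulmxA -gE mulmxA (resolves_difdif _ resC) mul0mx.
have [f [f0' fS]] := dependent_chain P0 step.
by exists f; rewrite f0'.
Qed.

(** A chain map over the zero map of the ideal is null-homotopic: the complex
    is exact, so each defect of the homotopy built so far lifts. *)
Lemma null_homotopy C I (f : forall i, 'M[S]_(rk C i)) : resolves C I ->
  f 0%N *m aug C = 0 -> (forall i, dif C i *m f i = f i.+1 *m dif C i) ->
  exists h : forall i, 'M[S]_(rk C i, rk C i.+1),
    f 0%N = h 0%N *m dif C 0 /\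
    forall i, f i.+1 = dif C i *m h i + h i.+1 *m dif C i.+1.
Proof.
move=> resC f0 fS.
have [h0 h0E] := resolves_exact0 resC f0.
pose P i (h : 'M[S]_(rk C i, rk C i.+1)) :=
  (f i.+1 - dif C i *m h) *m dif C i = 0.
have P0 : P 0%N h0 by rewrite /P mulmxBl -fS -mulmxA -h0E subrr.
have step i h : P i h ->
    exists g, f i.+1 = dif C i *m h + g *m dif C i.+1 /\ P i.+1 g.
  move=> Ph; have [g gE] := resolves_exactS resC Ph.
  have fE : f i.+1 = dif C i *m h + g *m dif C i.+1.
    by rewrite -gE addrC subrK.
  exists g; split=> //; rewrite /P mulmxBl -fS fE mulmxDr mulmxA.
  by rewrite (resolves_difdif _ resC) mul0mx add0r mulmxA subrr.
have [h [h0' hS]] := dependent_chain P0 step.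
by exists h; rewrite h0'.
Qed.

Local Notation const_part := (map_mx (mcoeff 0%MM)).

(** The two comparison maps compose to a map homotopic to the identity.  The
    differentials vanish at the origin, hence so does the homotopy term, and the
    constant parts of the comparison maps split. *)
Lemma minimal_rank_le C C' I : resolves C I -> resolves C' I -> minimal C ->
  forall i, (rk C i <= rk C' i)%N.
Proof.
move=> resC resC' minC i.
have [f [f0 fS]] := comparison_map resC resC' (fun=> id).
have [g [g0 gS]] := comparison_map resC' resC (fun=> id).
pose h j := f j *m g j - 1%:M.
have h0 : h 0%N *m aug C = 0.
  by rewrite /h mulmxBl mul1mx -mulmxA -g0 -f0 subrr.
have hS j : dif C j *m h j = h j.+1 *m dif C j.
  by rewrite /h mulmxBr mulmxBl mulmxA fS -!mulmxA gS mulmx1 mul1mx.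
have [k [k0 kS]] := null_homotopy resC h0 hS.
have difC0 j : const_part (dif C j) = 0.
  by apply/matrixP => a b; rewrite !mxE minC.
have : const_part (h i) = 0.
  case: i => [|i]; first by rewrite k0 map_mxM difC0 mulmx0.
  by rewrite kS map_mxD !map_mxM !difC0 mulmx0 mul0mx addr0.
rewrite /h map_mxB map_mxM map_mx1 => /eqP; rewrite subr_eq0 => /eqP.
exact: mulmx1_min.
Qed.

Lemma minimal_rank_unique C C' I : resolves C I -> resolves C' I ->
  minimal C -> minimal C' -> rk C =1 rk C'.
Proof.
move=> resC resC' mC mC' i; apply/eqP.
by rewrite eqn_leq !(minimal_rank_le (I := I)).
Qed.

End Resolutions.

(** * Mapping cones and linear resolutions *)

Section Cone.
Variables (K : fieldType) (N : nat).
Local Notation S := {mpoly K[N]}.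
Variables (a j : nat -> nat) (augM : 'M[S]_(a 0%N, 1)).
Variables (dM : forall i, 'M[S]_(a i.+1, a i)).
Variables (dJ : forall i, 'M[S]_(j i.+1, j i)).
Variables (h : forall i, 'M[S]_(j i, a i)).

Definition cone_rk i : nat := if i is k.+1 then (a k.+1 + j k)%N else a 0%N.

(** The complex dJ is mapped to dM by h and shifted by one step.  The two
    lowest degrees enter [cone_resolves] as hypotheses, which lets dM resolve a
    direct sum of two ideals although augmentations take values in the ring. *)
Definition cone_dif i : 'M[S]_(cone_rk i.+1, cone_rk i) :=
  match i with
  | 0 => col_mx (dM 0) (h 0)
  | k.+1 => block_mx (dM k.+1) 0 (h k.+1) (- dJ k)
  end.

Definition cone : complex K N := @Complex K N cone_rk augM cone_dif.

Lemma cone_resolves (I : S -> Prop) :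
  (forall p, I p <-> exists v : 'rV_(a 0%N), p = (v *m augM) 0 0) ->
  (forall v : 'rV_(a 0%N), v *m augM = 0 <->
     exists w u, v = w *m dM 0 + u *m h 0) ->
  (forall (v : 'rV_(a 1%N)) u, v *m dM 0 + u *m h 0 = 0 ->
     exists w, u = w *m dJ 0) ->
  (forall i (v : 'rV_(a i.+1)), v *m dM i = 0 <-> exists w, v = w *m dM i.+1) ->
  (forall i (v : 'rV_(j i.+1)), v *m dJ i = 0 <-> exists w, v = w *m dJ i.+1) ->
  (forall i, dJ i *m h i = h i.+1 *m dM i) ->
  resolves cone I.
Proof.
move=> HI H0 H1 exM exJ hS.
have dMM i : dM i.+1 *m dM i = 0.
  apply/row_matrixP => r; rewrite row0 row_mul; apply/exM.
  by exists (delta_mx 0 r); rewrite rowE.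
have dJJ i : dJ i.+1 *m dJ i = 0.
  apply/row_matrixP => r; rewrite row0 row_mul; apply/exJ.
  by exists (delta_mx 0 r); rewrite rowE.
(* The sign of dJ is absorbed in the preimage -w. *)
have exS i (v : 'rV_(a i.+1)) (u : 'rV_(j i)) w :
    v *m dM i + u *m h i = 0 -> u = w *m dJ i ->
    exists x, row_mx v u = x *m cone_dif i.+1.
  move=> vu uw; have [|y yE] := (exM i (v + w *m h i.+1)).1.
    by rewrite mulmxDl -[w *m _ *m _]mulmxA -hS mulmxA -uw.
  exists (row_mx y (- w)).
  by rewrite mul_row_block mulmx0 add0r !mulNmx mulmxN opprK -yE -uw addrK.
split=> //= [v|i v].
- rewrite H0; split=> [[w [u ->]]|[w ->]].
    by exists (row_mx w u); rewrite mul_row_col.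
  by exists (lsubmx w), (rsubmx w); rewrite -mul_row_col hsubmxK.
split=> [|[w ->]].
  rewrite -{1 2}[v]hsubmxK; case: i v => [|i] v /=.
    rewrite mul_row_col => vu; have [w uw] := H1 _ _ vu.
    exact: exS vu uw.
  rewrite mul_row_block mulmx0 add0r mulmxN.
  rewrite -[X in _ = X]row_mx0 => /eq_row_mx [vu /eqP].
  rewrite oppr_eq0 => /eqP /exJ [w uw].
  exact: exS vu uw.
rewrite -mulmxA; suff -> : cone_dif i.+1 *m cone_dif i = 0 by rewrite mulmx0.
case: i v w => [|i] _ _ /=.
  rewrite mul_block_col dMM mul0mx addr0 mulNmx hS subrr.
  exact: col_mx0.
rewrite mulmx_block !mulmx0 !mul0mx dMM !addr0 !add0r mulNmx hS subrr.
by rewrite mulNmx mulmxN opprK dJJ block_mx0.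
Qed.

End Cone.

Section LinearResolutions.
Variables (K : fieldType) (N : nat).
Local Notation S := {mpoly K[N]}.
Implicit Types (I J : S -> Prop) (C : complex K N).

Definition homog_mx e m n (D : 'M[S]_(m, n)) : Prop :=
  forall i j, D i j \is e.-homog.

Lemma homog_mulmx e f l m n (D : 'M[S]_(l, m)) (E : 'M[S]_(m, n)) :
  homog_mx e D -> homog_mx f E -> homog_mx (e + f) (D *m E).
Proof.
move=> hD hE i j; rewrite mxE; apply: rpred_sum => k _.
exact: dhomogM (hD _ _) (hE _ _).
Qed.

Lemma homog_polyC (c : K) : (c%:MP : S) \is 0.-homog.
Proof. by rewrite -[c%:MP]mulr1 mul_mpolyC dhomogZ // dhomog1. Qed.

(** In degree e only the constant term of q can meet the e-form p. *)
Lemma mcoeff_homogM e (p q : S) m : p \is e.-homog -> mdeg m = e ->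
  (p * q)@_m = p@_m * q@_0%MM.
Proof.
move=> hp hm; rewrite -{1}[q](subrK (q@_0%MM)%:MP) mulrDr mcoeffD.
rewrite [p * _%:MP]mulrC mcoeffCM [X in _ + X]mulrC.
rewrite [X in X + _](_ : _ = 0) ?add0r //.
apply/eqP; rewrite mcoeff_eq0; apply/negP => /msuppM_le /allpairsP.
case=> -[m1 m2] /= [m1p m2q mE].
have m1e := dhomogP _ _ _ hp m1 m1p.
move: hm; rewrite mE mdegD m1e -[X in _ = X]addn0 => /addnI /eqP.
rewrite mdeg_eq0 => /eqP m20.
by move: m2q; rewrite m20 mcoeff_msupp mcoeffB mcoeffC eqxx mulr1 subrr eqxx.
Qed.

Definition const_mx_part m n (D : 'M[S]_(m, n)) : 'M[S]_(m, n) :=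
  map_mx (fun p => (p@_0%MM)%:MP) D.

Lemma const_mx_part_homog m n (D : 'M[S]_(m, n)) : homog_mx 0 (const_mx_part D).
Proof. by move=> i j; rewrite mxE homog_polyC. Qed.

Lemma const_mx_part1 n : const_mx_part (1%:M : 'M[S]_n) = 1%:M.
Proof.
apply/matrixP => i j.
by rewrite !mxE mcoeffMn mcoeff1 eqxx mpolyCMn mpolyC1.
Qed.

(** Compare the coefficients in the lowest possible degree. *)
Lemma const_mx_part_comm e k l m n (D : 'M[S]_(k, l)) (F : 'M[S]_(l, n))
    (G : 'M[S]_(k, m)) (E : 'M[S]_(m, n)) : homog_mx e D -> homog_mx e E ->
  D *m F = G *m E -> D *m const_mx_part F = const_mx_part G *m E.
Proof.
move=> hD hE /matrixP FG; apply/matrixP => i j; apply/mpolyP => mu.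
have [mue|mue] := eqVneq (mdeg mu) e; last first.
  have hl := homog_mulmx hD (const_mx_part_homog F) i j.
  have hr := homog_mulmx (const_mx_part_homog G) hE i j.
  by rewrite (dhomog_nemf_coeff hl) ?addn0 // (dhomog_nemf_coeff hr).
have := congr1 (mcoeff mu) (FG i j); rewrite !mxE !raddf_sum /=.
rewrite (eq_bigr (fun r => (D i r * const_mx_part F r j)@_mu)) => [|r _].
  move=> ->; apply: eq_bigr => r _.
  by rewrite mxE mulrC (mcoeff_homogM _ (hE _ _)) // mcoeffCM mulrC.
rewrite mxE (mcoeff_homogM _ (hD _ _)) // (mcoeff_homogM _ (hD _ _)) //.
by rewrite mpolyCK.
Qed.

(** Generators in degree m and linear differentials: the i-th module then sits
    in the single degree m + i, and both gradedness and minimality are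
    automatic. *)
Definition linear_resolution C m I : Prop :=
  [/\ resolves C I, homog_mx m (aug C) & forall i, homog_mx 1 (dif C i)].

Lemma linear_graded C m I : linear_resolution C m I -> graded C.
Proof.
case=> _ hA hD; exists (fun i _ => (m + i)%N); split=> [r|i r c].
  by rewrite addn0; exact: hA.
by split=> [_|]; [rewrite addnS subSnn; exact: hD|lia].
Qed.

Lemma linear_minimal C m I : linear_resolution C m I -> minimal C.
Proof.
case=> _ _ hD i r c; apply: (dhomog_nemf_coeff (hD i r c)).
by rewrite /= mdeg0.
Qed.

(** Ideals generated in the same degree have comparison maps with constant
    entries, namely the constant parts of any comparison map. *)
Lemma linear_comparison_map C C' m I J :
  linear_resolution C m I -> linear_resolution C' m J ->
  (forall p, I p -> J p) ->
  exists f : forall i, 'M[S]_(rk C i, rk C' i),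
  [/\ aug C = f 0%N *m aug C',
      forall i, dif C i *m f i = f i.+1 *m dif C' i
    & forall i, homog_mx 0 (f i)].
Proof.
move=> [resC hA hD] [resC' hA' hD'] sIJ.
have [f [f0 fS]] := comparison_map resC resC' sIJ.
exists (fun i => const_mx_part (f i)); split=> [|i|i].
- have := const_mx_part_comm (F := 1%:M) hA hA'.
  by rewrite const_mx_part1 !mulmx1; exact.
- exact: const_mx_part_comm.
exact: const_mx_part_homog.
Qed.

End LinearResolutions.

Section MappingCone.
Variables (K : fieldType) (N : nat).
Local Notation S := {mpoly K[N]}.
Implicit Types (I J : S -> Prop) (C : complex K N).

Lemma mpolyX_neq0 m : 'X_[m] != 0 :> S.
Proof. by rewrite -msupp_eq0 msuppX. Qed.

(** The sequence 0 -> IJ -> IA + IB -> I -> 0 is exact, with maps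
    c |-> (x_b c, - x_a c) and (a, b) |-> x_a a + x_b b.  The first map is a
    variable times an inclusion, so it lifts to linear matrices and the cone
    stays linear. *)
Lemma linear_mapping_cone (IA IB IJ I : S -> Prop) (xa xb : 'I_N) m CA CB CJ :
  linear_resolution CA m IA -> linear_resolution CB m IB ->
  linear_resolution CJ m IJ ->
  (forall p, IJ p -> IA p) -> (forall p, IJ p -> IB p) ->
  (forall p, I p <-> exists a b, [/\ IA a, IB b & p = 'X_xa * a + 'X_xb * b]) ->
  (forall a b, IA a -> IB b -> 'X_xa * a + 'X_xb * b = 0 ->
     exists c, [/\ IJ c, a = 'X_xb * c & b = - ('X_xa * c)]) ->
  exists C, linear_resolution C m.+1 I /\
    forall i, rk C i =
      (rk CA i + rk CB i + (if i is k.+1 then rk CJ k else 0))%N.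
Proof.
move=> linA linB linJ sJA sJB sumAB syzAB.
have [f [f0 fS fh]] := linear_comparison_map linJ linA sJA.
have [g [g0 gS gh]] := linear_comparison_map linJ linB sJB.
case: linA => resA hA hDA; case: linB => resB hB hDB.
case: linJ => resJ hJ hDJ.
have [inA exA0 exA] := resA; have [inB exB0 exB] := resB.
have [inJ exJ0 exJ] := resJ.
pose augM := col_mx ('X_xa *: aug CA) ('X_xb *: aug CB).
pose dM i := block_mx (dif CA i) 0 0 (dif CB i).
pose h i := row_mx ('X_xb *: f i) (- ('X_xa *: g i)).
have XhomU x : ('X_x : S) \is 1.-homog by rewrite dhomogX /= mdeg1.
have augME v : v *m augM =
    'X_xa *: (lsubmx v *m aug CA) + 'X_xb *: (rsubmx v *m aug CB).
  by rewrite -{1}[v]hsubmxK mul_row_col -!scalemxAr.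
have dME i (v : 'rV_(rk CA i.+1 + rk CB i.+1)) :
    v *m dM i = row_mx (lsubmx v *m dif CA i) (rsubmx v *m dif CB i).
  by rewrite -{1}[v]hsubmxK mul_row_block !mulmx0 addr0 add0r.
have hE i (u : 'rV_(rk CJ i)) : u *m h i =
    row_mx ('X_xb *: (u *m f i)) (- ('X_xa *: (u *m g i))).
  by rewrite mul_mx_row mulmxN -!scalemxAr.
have dA0 := resolves_difaug resA; have dB0 := resolves_difaug resB.
pose C := cone augM dM (dif CJ) h.
exists C; split; last by case=> [|i] /=; rewrite ?addn0.
split.
- apply: cone_resolves => [p|v|v u|i v||i].
  + rewrite sumAB; split=> [[a [b [/inA [va ->] /inB [vb ->] ->]]]|[v ->]].
      exists (row_mx va vb).
      by rewrite augME row_mxKl row_mxKr !mxE.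
    exists ((lsubmx v *m aug CA) 0 0), ((rsubmx v *m aug CB) 0 0).
    split; [by apply/inA; eexists|by apply/inB; eexists|].
    by rewrite augME !mxE.
  + split=> [vM|[w [u ->]]]; last first.
      rewrite augME dME hE add_row_mx row_mxKl row_mxKr.
      rewrite !mulmxDl -!mulmxA dA0 dB0 !mulmx0 !add0r mulNmx -!scalemxAl.
      by rewrite -!mulmxA -f0 -g0 scalerN !scalerA mulrC subrr.
    have [|||c [/inJ [u ->] aE bE]] :=
        syzAB ((lsubmx v *m aug CA) 0 0) ((rsubmx v *m aug CB) 0 0).
    * by apply/inA; eexists.
    * by apply/inB; eexists.
    * by have /matrixP/(_ 0 0) := vM; rewrite augME !mxE.
    have mx11 (x y : 'M[S]_(1, 1)) : x 0 0 = y 0 0 -> x = y.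
      by move=> xy; apply/matrixP => i j; rewrite !ord1.
    have [|wa waE] := resolves_exact0 (V := lsubmx v - 'X_xb *: (u *m f 0%N)) resA.
      apply: mx11; rewrite mulmxBl -scalemxAl -mulmxA -f0 !mxE.
      by move: aE; rewrite !mxE => ->; rewrite subrr.
    have [|wb wbE] := resolves_exact0 (V := rsubmx v + 'X_xa *: (u *m g 0%N)) resB.
      apply: mx11; rewrite mulmxDl -scalemxAl -mulmxA -g0 !mxE.
      by move: bE; rewrite !mxE => ->; rewrite addNr.
    exists (row_mx wa wb), u; rewrite dME hE row_mxKl row_mxKr add_row_mx.
    by rewrite -waE -wbE subrK addrK hsubmxK.
  + rewrite dME hE add_row_mx -[X in _ = X]row_mx0 => /eq_row_mx [va _].
    apply: (resolves_exact0 resJ); rewrite f0.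
    have := congr1 (mulmx^~ (aug CA)) va.
    rewrite mul0mx mulmxDl -mulmxA dA0 mulmx0 add0r -scalemxAl -mulmxA.
    move=> /matrixP E; apply/matrixP => r c; move: (E r c).
    by rewrite !mxE => /eqP; rewrite mulf_eq0 (negPf (mpolyX_neq0 _)) => /eqP.
  + rewrite dME; split=> [|[w ->]].
      rewrite -[X in _ = X]row_mx0 => /eq_row_mx [/exA [wa wE] /exB [wb wE']].
      by exists (row_mx wa wb); rewrite dME row_mxKl row_mxKr -wE -wE' hsubmxK.
    rewrite dME row_mxKl row_mxKr -!mulmxA (resolves_difdif _ resA).
    by rewrite (resolves_difdif _ resB) !mulmx0 row_mx0.
  + exact: exJ.
  + rewrite mul_mx_row mul_row_block !mulmx0 addr0 add0r mulmxN mulNmx.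
    by rewrite -!scalemxAr -!scalemxAl fS gS.
- move=> r c; rewrite /C /= mxE; case: split => k; rewrite mxE.
    exact: (dhomogM (XhomU _) (hA _ _)).
  exact: (dhomogM (XhomU _) (hB _ _)).
have hM i : homog_mx 1 (dM i).
  by move=> r c; rewrite !mxE; case: split => k; rewrite mxE;
    case: split => l; rewrite ?mxE ?dhomog0; [exact: hDA|by []|by []|exact: hDB].
have hh i : homog_mx 1 (h i).
  move=> r c; rewrite !mxE; case: split => k; rewrite !mxE ?dhomogN.
    exact: (dhomogM (XhomU _) (fh i _ _)).
  exact: (dhomogM (XhomU _) (gh i _ _)).
case=> [|i] r c /=.
  by rewrite mxE; case: split => k; [exact: hM|exact: hh].
rewrite !mxE; case: split => k; rewrite mxE; case: split => l.
- exact: hM.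
- by rewrite mxE dhomog0.
- exact: hh.
by rewrite mxE dhomogN; exact: hDJ.
Qed.

End MappingCone.


(** * Monomial ideals *)

Section MonomialIdeals.
Variables (K : fieldType) (N : nat).
Local Notation S := {mpoly K[N]}.
Implicit Types M : 'X_{1..N} -> Prop.

Lemma monomial_ideal0 M : monomial_ideal M (0 : S).
Proof. by exists [::]; split=> //; rewrite big_nil. Qed.

Lemma monomial_idealD M (p q : S) :
  monomial_ideal M p -> monomial_ideal M q -> monomial_ideal M (p + q).
Proof.
move=> [s [sM ->]] [t [tM ->]]; exists (s ++ t); split; last by rewrite big_cat.
by move=> x; rewrite mem_cat => /orP [/sM|/tM].
Qed.

Lemma monomial_ideal_sum M (T : eqType) (s : seq T) (F : T -> S) :
  {in s, forall x, monomial_ideal M (F x)} -> monomial_ideal M (\sum_(x <- s) F x).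
Proof.
elim: s => [|x s IHs] sM; first by rewrite big_nil; exact: monomial_ideal0.
rewrite big_cons; apply: monomial_idealD; first by apply: sM; rewrite mem_head.
by apply: IHs => y ys; apply: sM; rewrite inE ys orbT.
Qed.

Lemma monomial_ideal_mulX M (p : S) m : M m -> monomial_ideal M (p * 'X_[m]).
Proof.
move=> Mm; exists [:: (p, m)]; split; last by rewrite big_seq1.
by move=> x; rewrite inE => /eqP ->.
Qed.

Lemma monomial_idealP M (p : S) :
  monomial_ideal M p <->
  forall m, m \in msupp p -> exists2 g, M g & (g <= m)%MM.
Proof.
split=> [[s [sM ->]] m /msupp_sum_le /flattenP [_ /mapP [x xs ->]]|supp].
  rewrite (perm_mem (msuppMX _ _)) => /mapP [m' _ ->].
  exists x.2; last by rewrite lem_addr.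
  by apply: sM; move: xs; rewrite mem_filter.
rewrite [p]mpolyE; apply: monomial_ideal_sum => m /supp [g Mg gm].
by rewrite -(submK gm) mpolyXD scalerAl; exact: monomial_ideal_mulX.
Qed.

Lemma monomial_idealX M m :
  monomial_ideal M ('X_[m] : S) <-> exists2 g, M g & (g <= m)%MM.
Proof.
rewrite monomial_idealP; split=> [|ex m']; first by apply; rewrite msuppX mem_head.
by rewrite msuppX inE => /eqP ->.
Qed.

Lemma eq_monomial_ideal M M' : (forall m, M m <-> M' m) ->
  forall p : S, monomial_ideal M p <-> monomial_ideal M' p.
Proof.
by move=> MM' p; split=> -[s [sM ->]]; exists s; split=> // x /sM /MM'.
Qed.

Lemma monomial_ideal_sub M M' :
  (forall m, M m -> exists2 g, M' g & (g <= m)%MM) ->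
  forall p : S, monomial_ideal M p -> monomial_ideal M' p.
Proof.
move=> MM' p /monomial_idealP sM; apply/monomial_idealP => m /sM [g /MM'].
by move=> [g' Mg' gg'] gm; exists g' => //; exact: lepm_trans gm.
Qed.

Lemma lem_mdeg (g m : 'X_{1..N}) : (g <= m)%MM -> (mdeg g <= mdeg m)%N.
Proof. by move=> gm; rewrite -(submK gm) mdegD leq_addl. Qed.

Lemma lem_mdeg_eq (g m : 'X_{1..N}) :
  (g <= m)%MM -> (mdeg m <= mdeg g)%N -> g = m.
Proof.
move=> gm; rewrite -{1}(submK gm) mdegD -{2}[mdeg g]add0n leq_add2r leqn0.
by rewrite mdeg_eq0 => /eqP mg0; rewrite -[RHS](submK gm) mg0 add0m.
Qed.

Lemma monomial_idealMX M M' m0 (p : S) :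
  (forall m, M m -> exists2 g, M' g & (g <= m0 + m)%MM) ->
  monomial_ideal M p -> monomial_ideal M' ('X_[m0] * p).
Proof.
move=> MM' /monomial_idealP sM; apply/monomial_idealP => m.
rewrite mulrC (perm_mem (msuppMX _ _)) => /mapP [m1 /sM [g Mg gm] ->].
have [g' Mg' gg'] := MM' g Mg; exists g' => //.
apply: lepm_trans gg' _; apply/mnm_lepP => v.
by rewrite !mnmDE leq_add2l; exact/mnm_lepP.
Qed.

Lemma monomial_ideal_factor M M' m0 (p : S) :
  (forall m, M m -> exists2 m', M' m' & m = (m0 + m')%MM) ->
  monomial_ideal M p -> exists2 c, monomial_ideal M' c & p = 'X_[m0] * c.
Proof.
move=> MM' [s [+ ->]]; elim: s => [|x s IHs] sM.
  by exists 0; [exact: monomial_ideal0|rewrite big_nil mulr0].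
rewrite big_cons; have [|c cM' ->] := IHs.
  by move=> y ys; apply: sM; rewrite inE ys orbT.
have [m' Mm' mE] := MM' _ (sM x (mem_head _ _)).
exists (x.1 * 'X_[m'] + c).
  by apply: monomial_idealD => //; exact: monomial_ideal_mulX.
by rewrite mulrDr mE mpolyXD mulrCA.
Qed.

(** Generators of one common degree cannot divide each other properly, so each
    of them must belong to every generating set of monomials. *)
Lemma equigenerated_minimal_generators (G0 : seq 'X_{1..N}) D (I : S -> Prop) :
  uniq G0 -> {in G0, forall m, mdeg m = D} -> generates G0 I ->
  number_of_minimal_generators I (size G0).
Proof.
move=> uG0 degG0 genG0.
have inI G m : generates G I -> m \in G -> I 'X_[m].
  by move=> genG mG; apply/(genG _); apply/monomial_idealX; exists m; rewrite ?lepm_refl.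
have subI G G' : {subset G <= G'} -> forall p : S,
    monomial_ideal (fun m => m \in G) p -> monomial_ideal (fun m => m \in G') p.
  by move=> GG'; apply: monomial_ideal_sub => m /GG'; exists m; rewrite ?lepm_refl.
split=> [|G [uG genG minG]].
  exists G0; split=> // m mG0 gen.
  have /monomial_idealX [g gG0 gm] := (gen 'X_[m]).1 (inI _ _ genG0 mG0).
  have gG0' := mem_rem gG0; have gE : g = m.
    by apply: lem_mdeg_eq => //; rewrite !degG0.
  by move: gG0; rewrite gE mem_rem_uniq // inE eqxx.
have sG0G : {subset G0 <= G}.
  move=> m mG0; have /genG/monomial_idealX [g gG gm] := inI _ _ genG0 mG0.
  have /genG0/monomial_idealX [g0 g0G0 g0g] := inI _ _ genG gG.
  rewrite -(lem_mdeg_eq gm) //; apply: leq_trans (lem_mdeg g0g).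
  by rewrite !degG0.
suff sGG0 : {subset G <= G0}.
  by apply/eqP; rewrite eqn_leq !uniq_leq_size.
move=> g gG; apply/negPn/negP => gG0; apply: (minG g gG) => p; split.
  move/genG0; apply: subI => m mG0.
  rewrite mem_rem_uniq // inE sG0G // andbT.
  by apply: contraNneq gG0 => <-.
by move=> H; apply/genG; apply: subI H => m /mem_rem.
Qed.

End MonomialIdeals.


(** * Labelled families of sign vectors *)

Section SignFamilies.
Variables (N n : nat) (va vb : 'I_n -> 'I_N).

(** [None] stands for the sign zero, and [Some true], [Some false] for the two
    sides of a hyperplane, whose variables are indexed by va and vb. *)
Definition sign_vector := {ffun 'I_n -> option bool}.
Implicit Types (u w : sign_vector) (P : {set sign_vector}) (s : seq 'I_n).

Definition zeros u : {set 'I_n} := [set k | u k == None].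

Definition side_label k (x : option bool) : 'X_{1..N} :=
  ((if x != Some false then U_(va k) else 0) +
   (if x != Some true then U_(vb k) else 0))%MM.

Definition label s u : 'X_{1..N} := (\sum_(k <- s) side_label k (u k))%MM.

Local Notation total := (label (enum 'I_n)).

Definition upd u e x : sign_vector := [ffun k => if k == e then x else u k].

Definition slice P e x : {set sign_vector} := [set u in P | u e == x].

(** The edges outside s have been decided.  Elimination bounds the label over all
    edges, so that it passes to slices unchanged; as decided edges contribute
    equally to all labels, the bound also holds for the labels over s. *)
Record sign_family s P : Prop := SignFamily {
  family_refine : forall u e b, u \in P -> e \in s -> u e = None ->
    upd u e (Some b) \in P;
  family_elim : forall u w e, u \in P -> w \in P -> e \in s ->
    u e = Some true -> w e = Some false ->
    exists t, [/\ t \in P, t e = None, forall k, u k = w k -> t k = u k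
      & forall v, (total t v <= maxn (total u v) (total w v))%N];
  family_agree : forall u w e, u \in P -> w \in P -> e \notin s -> u e = w e
}.

Lemma label_cons e s u : label (e :: s) u = (side_label e (u e) + label s u)%MM.
Proof. by rewrite /label big_cons. Qed.

Lemma label_nil u : label [::] u = 0%MM.
Proof. by rewrite /label big_nil. Qed.

Lemma label_upd e s u x : e \notin s -> label s (upd u e x) = label s u.
Proof.
move=> es; apply: eq_big_seq => k ks; rewrite ffunE.
by case: eqP ks es => // -> ->.
Qed.

Lemma label_total_agree s u w v : uniq s ->
  (forall k, k \notin s -> u k = w k) ->
  (total u v + label s w v = total w v + label s u v)%N.
Proof.
move=> us agree.
have E t : total t v = (label s t v + \sum_(k | k \notin s) side_label k (t k) v)%N.
  rewrite !mnm_sumE big_enum /= (bigID (mem s)) /=; congr addn.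
  by rewrite big_uniq.
rewrite (E u) (E w).
have -> : (\sum_(k | k \notin s) side_label k (u k) v =
           \sum_(k | k \notin s) side_label k (w k) v)%N.
  by apply: eq_bigr => k /agree ->.
by lia.
Qed.

Lemma slice_family e s P x : uniq (e :: s) -> sign_family (e :: s) P ->
  sign_family s (slice P e x).
Proof.
move=> /= /andP [es us] [ref elim agree]; split.
- move=> u k b; rewrite !inE => /andP [uP ux] ks uk.
  rewrite ref ?inE ?ks ?orbT // ffunE ifN //.
  by apply: contraNneq es => ->.
- move=> u w k; rewrite !inE => /andP [uP /eqP ux] /andP [wP /eqP wx] ks uk wk.
  have [|t [tP tk tE tl]] := elim u w k uP wP _ uk wk.
    by rewrite inE ks orbT.
  by exists t; split=> //; rewrite inE tP tE ?ux ?wx /=.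
move=> u w k; rewrite !inE => /andP [uP /eqP ux] /andP [wP /eqP wx] ks.
have [->|ke] := eqVneq k e; first by rewrite ux wx.
by apply: agree; rewrite // inE negb_or ke.
Qed.

Lemma slice_refine e s P u b : sign_family (e :: s) P ->
  u \in slice P e None -> upd u e (Some b) \in slice P e (Some b).
Proof.
move=> fam; rewrite !inE => /andP [uP /eqP ue].
by rewrite (family_refine fam) ?mem_head // ffunE !eqxx.
Qed.

Lemma card_slices (Q : pred sign_vector) P e :
  #|[set u in P | Q u]| =
    (#|[set u in slice P e (Some true) | Q u]| +
     #|[set u in slice P e (Some false) | Q u]| +
     #|[set u in slice P e None | Q u]|)%N.
Proof.
rewrite -(cardsID [set u : sign_vector | u e == None]) addnC; congr addn; last first.
  by apply: eq_card => u; rewrite !inE andbAC.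
rewrite -(cardsID [set u : sign_vector | u e == Some true]); congr addn.
  by apply: eq_card => u; rewrite !inE; case: (u e) => [[]|]; rewrite ?andbF ?andbT.
by apply: eq_card => u; rewrite !inE; case: (u e) => [[]|]; rewrite ?andbF ?andbT.
Qed.

Lemma family_nil P u : sign_family [::] P -> u \in P -> P = [set u].
Proof.
move=> fam uP; apply/setP => w; rewrite inE; apply/idP/eqP => [wP|->//].
by apply/ffunP => k; exact: (family_agree fam).
Qed.

Section Ideal.
Variable K : fieldType.
Local Notation S := {mpoly K[N]}.

Definition family_ideal s P : S -> Prop :=
  monomial_ideal (fun m => exists2 u, u \in P & m = label s u).

Lemma family_ideal_slices e s P p : uniq (e :: s) -> sign_family (e :: s) P ->
  family_ideal (e :: s) P p <->
  exists a b, [/\ family_ideal s (slice P e (Some true)) a,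
                 family_ideal s (slice P e (Some false)) b
               & p = 'X_(va e) * a + 'X_(vb e) * b].
Proof.
move=> /= /andP [es us] fam; split; last first.
  move=> [a [b [aI bI ->]]]; apply: monomial_idealD.
    apply: monomial_idealMX aI => m [u]; rewrite inE => /andP [uP /eqP ue] ->.
    exists (label (e :: s) u); first by exists u.
    by rewrite label_cons ue /side_label /= addm0 lepm_refl.
  apply: monomial_idealMX bI => m [u]; rewrite inE => /andP [uP /eqP ue] ->.
  exists (label (e :: s) u); first by exists u.
  by rewrite label_cons ue /side_label /= add0m lepm_refl.
move=> [l [+ ->]]; elim: l => [|x l IHl] lP.
  exists 0, 0; split; try exact: monomial_ideal0.
  by rewrite big_nil !mulr0 addr0.
rewrite big_cons; have [|a [b [aI bI ->]]] := IHl.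
  by move=> y yl; apply: lP; rewrite inE yl orbT.
have [u uP uE] := lP x (mem_head _ _); rewrite uE label_cons.
have uS x' : u e = x' -> exists2 w, w \in slice P e x' & label s u = label s w.
  by move=> ue; exists u => //; rewrite inE uP ue /=.
case ue: (u e) => [[]|]; rewrite /side_label /= ?addm0 ?add0m.
- exists (x.1 * 'X_[label s u] + a), b; split=> //.
    by apply: monomial_idealD => //; apply: monomial_ideal_mulX; exact: uS.
  by rewrite mpolyXD; ring.
- exists a, (x.1 * 'X_[label s u] + b); split=> //.
    by apply: monomial_idealD => //; apply: monomial_ideal_mulX; exact: uS.
  by rewrite mpolyXD; ring.
exists (x.1 * 'X_(vb e) * 'X_[label s u] + a), b; split=> //.
  apply: monomial_idealD => //; apply: monomial_ideal_mulX.
  exists (upd u e (Some true)); last by rewrite label_upd.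
  by apply: (slice_refine (s := s)) => //; rewrite inE uP ue /=.
by rewrite !mpolyXD; ring.
Qed.

Lemma family_ideal_refine e s P b p : uniq (e :: s) -> sign_family (e :: s) P ->
  family_ideal s (slice P e None) p -> family_ideal s (slice P e (Some b)) p.
Proof.
move=> /= /andP [es us] fam; apply: monomial_ideal_sub => m [u uP ->].
exists (label s u); last exact: lepm_refl.
exists (upd u e (Some b)); last by rewrite label_upd.
exact: slice_refine fam uP.
Qed.

(** A monomial in the support of x a = - y b is a multiple of a label from each
    side of e, so elimination provides a label with a zero at e dividing it. *)
Lemma family_ideal_syzygy e s P a b : uniq (e :: s) -> sign_family (e :: s) P ->
  family_ideal s (slice P e (Some true)) a ->
  family_ideal s (slice P e (Some false)) b ->
  'X_(va e) * a + 'X_(vb e) * b = 0 ->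
  exists c, [/\ family_ideal s (slice P e None) c,
               a = 'X_(vb e) * c & b = - ('X_(va e) * c)].
Proof.
move=> us fam aI bI /eqP; rewrite addr_eq0 => /eqP ab.
have [ref elim agree] := fam.
have {aI}aI : monomial_ideal (fun m => exists2 u, u \in slice P e (Some true) &
    m = label (e :: s) u) ('X_(va e) * a).
  apply: monomial_idealMX aI => m [u uP ->]; exists (label (e :: s) u).
    by exists u.
  move: uP; rewrite inE => /andP [uP /eqP ue].
  by rewrite label_cons ue /side_label /= addm0 lepm_refl.
have {bI}bI : monomial_ideal (fun m => exists2 u, u \in slice P e (Some false) &
    m = label (e :: s) u) ('X_(vb e) * - b).
  have {}bI : family_ideal s (slice P e (Some false)) (- b).
    apply/monomial_idealP => m; rewrite (perm_mem (msuppN _)).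
    by move/monomial_idealP: bI; exact.
  apply: monomial_idealMX bI => m [u uP ->]; exists (label (e :: s) u).
    by exists u.
  move: uP; rewrite inE => /andP [uP /eqP ue].
  by rewrite label_cons ue /side_label /= add0m lepm_refl.
have : monomial_ideal (fun m => exists2 u, u \in slice P e None &
    m = label (e :: s) u) ('X_(va e) * a).
  apply/monomial_idealP => m mp; move/monomial_idealP/(_ m mp): aI.
  move: mp; rewrite ab -mulrN => mp; move/monomial_idealP/(_ m mp): bI.
  move=> [_ [w + ->] wm] [_ [u + ->] um]; rewrite !inE.
  move=> /andP [wP /eqP we] /andP [uP /eqP ue].
  have [t [tP te tE tl]] := elim u w e uP wP (mem_head _ _) ue we.
  exists (label (e :: s) t); first by exists t => //; rewrite inE tP te /=.
  apply/mnm_lepP => v; move/mnm_lepP/(_ v): wm; move/mnm_lepP/(_ v): um.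
  have := tl v.
  have := label_total_agree v us (fun k ks => agree u t k uP tP ks).
  have := label_total_agree v us (fun k ks => agree w t k wP tP ks).
  lia.
move=> /(monomial_ideal_factor
  (M' := fun m => exists2 u, u \in slice P e None & m = label s u)
  (m0 := (U_(va e) + U_(vb e))%MM)) [m [u uP ->]|c cI cE].
  exists (label s u); first by exists u.
  by move: uP; rewrite inE => /andP [_ /eqP ue]; rewrite label_cons ue.
have X0 v : 'X_v != 0 :> S := mpolyX_neq0 _ _.
exists c; split=> //.
  by apply: (mulfI (X0 (va e))); rewrite cE mpolyXD mulrA.
apply: (mulfI (X0 (vb e))); rewrite -['X_(vb e) * b]opprK -ab cE mpolyXD.
by ring.
Qed.

(** At most one sign vector is left, and its label over no edge is 1. *)
Lemma family_resolution_nil P : sign_family [::] P ->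
  exists C, linear_resolution C 0 (family_ideal [::] P) /\
    forall i, rk C i = (if i is 0 then #|P| else 0)%N.
Proof.
move=> fam; pose r i := (if i is 0 then #|P| else 0)%N.
pose C := @Complex K N r (const_mx 1) (fun i => 0).
exists C; split=> //.
have cP : (#|P| <= 1)%N.
  have [->|[u /(family_nil fam) ->]] := set_0Vmem P; first by rewrite cards0.
  by rewrite cards1.
have inP p : family_ideal [::] P p <-> (#|P| = 0%N -> p = 0).
  have [->|[u uP]] := set_0Vmem P.
    rewrite cards0; split=> [/monomial_idealP p0 _|->//]; last exact: monomial_ideal0.
    apply/eqP; rewrite -msupp_eq0; case: (msupp p) p0 => // m l.
    by move=> /(_ m (mem_head _ _)) [g [u]]; rewrite inE.
  split=> [_ /eqP|_]; first by rewrite cards_eq0 => /eqP P0; rewrite P0 inE in uP.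
  apply/monomial_idealP => m _; exists 0%MM; last by apply/mnm_lepP => v; rewrite mnm0E.
  by exists u; rewrite ?label_nil.
split=> //.
- split=> [p|v|i v].
  + rewrite inP /=; split=> [p0|[v ->] P0]; last first.
      by rewrite mxE big1 // => -[k kP]; exfalso; rewrite P0 in kP.
    exists (const_mx p); rewrite mxE; under eq_bigr do rewrite !mxE mulr1.
    rewrite sumr_const card_ord.
    by case: #|P| cP p0 => [|[|]] // _ ->.
  + split=> [|[w ->]]; last by rewrite mulmx0 mul0mx.
    move=> /matrixP/(_ 0 0); rewrite !mxE => v0; exists 0; rewrite mul0mx.
    apply/rowP => k; rewrite mxE -[RHS]v0 (bigD1 k) //= mxE mulr1 big1 ?addr0 //.
    move=> l /eqP []; apply/val_inj => /=.
    have := ltn_ord l; have := ltn_ord k; rewrite /= in l k *.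
    by move=> /= kP lP; move: (leq_trans kP cP) (leq_trans lP cP); do 2 case: (nat_of_ord _).
  split=> [_|_]; first by exists 0; apply/rowP => -[].
  by apply/rowP => k; rewrite mulmx0.
- by move=> i j; rewrite mxE dhomog1.
by move=> i r' c; rewrite mxE dhomog0.
Qed.

(** One basis vector of the i-th module for each sign vector with i zeros: a zero
    at e comes from the slice that the mapping cone shifts by one. *)
Lemma family_resolution s P : uniq s -> sign_family s P ->
  exists C, linear_resolution C (size s) (family_ideal s P) /\
    forall i, rk C i = #|[set u in P | count (mem (zeros u)) s == i]|.
Proof.
elim: s P => [|e s IHs] P.
  move=> _ /family_resolution_nil [C [linC rkC]]; exists C; split=> // i.
  rewrite rkC; case: i => [|i] /=; first by apply: eq_card => u; rewrite inE andbT.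
  by rewrite eq_card0 // => u; rewrite !inE /= andbF.
move=> us fam; have us' : uniq s by case/andP: us.
have [CA [linA rkA]] := IHs _ us' (slice_family (Some true) us fam).
have [CB [linB rkB]] := IHs _ us' (slice_family (Some false) us fam).
have [CJ [linJ rkJ]] := IHs _ us' (slice_family None us fam).
have [||||C [linC rkC]] := linear_mapping_cone (I := family_ideal (e :: s) P)
    (xa := va e) (xb := vb e) linA linB linJ.
- by move=> p; exact: family_ideal_refine.
- by move=> p; exact: family_ideal_refine.
- by move=> p; exact: family_ideal_slices.
- by move=> a b; exact: family_ideal_syzygy.
exists C; split=> // i; rewrite rkC (card_slices _ P e) rkA rkB; congr (_ + _ + _)%N.
- apply: eq_card => u; rewrite !inE /= inE; case: (u \in P) => //=.
  by case: (u e) => [[]|].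
- apply: eq_card => u; rewrite !inE /= inE; case: (u \in P) => //=.
  by case: (u e) => [[]|].
case: i => [|i].
  rewrite eq_card0 // => u; rewrite !inE /= inE.
  by case: eqP; rewrite ?andbF.
rewrite rkJ; apply: eq_card => u; rewrite !inE /= inE.
by case: eqP => _; rewrite ?andbF.
Qed.

End Ideal.
End SignFamilies.

(** * Chambers and invariants of the label ideal *)

Section Invariants.
Variables (N n : nat) (va vb : 'I_n -> 'I_N).
Implicit Types (u w : sign_vector n) (P : {set sign_vector n}).
Implicit Types (s : seq 'I_n) (F : {set 'I_n}).
Local Notation label := (label va vb).
Local Notation total := (label (enum 'I_n)).
Local Notation sign_family := (sign_family va vb).

(** For the sign vectors of points, these are the sets of hyperplanes in s with a
    common point. *)
Definition flats s P : {set {set 'I_n}} :=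
  [set F : {set 'I_n} | (F \subset s) && [exists u in P, F \subset zeros u]].

Lemma flatsP s P F : reflect (F \subset s /\ exists2 u, u \in P & F \subset zeros u)
  (F \in flats s P).
Proof.
rewrite inE; apply: (iffP andP) => [[Fs /exists_inP]|[Fs ex]] //.
by split=> //; apply/exists_inP.
Qed.

Lemma in_slice u P e x : (u \in slice P e x) = (u \in P) && (u e == x).
Proof. by rewrite inE. Qed.

(** Both sides are additive in the slices + and - of the first edge e.  For flats,
    those avoiding e form the union of the flats of the two slices, and those
    containing e correspond to the flats of the zero slice, which by refinement
    and elimination are the common flats of the two slices. *)
Lemma card_chambers s P : uniq s -> sign_family s P ->
  #|[set u in P | all (fun k => u k != None) s]| = #|flats s P|.
Proof.
elim: s P => [|e s IHs] P.
  move=> _ fam; have [->|[u uP]] := set_0Vmem P.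
    rewrite !eq_card0 // => F; last by rewrite !inE.
    by apply/negbTE/flatsP => -[_ [w]]; rewrite inE.
  rewrite (family_nil fam uP) (_ : flats _ _ = [set set0]) ?cards1.
    by rewrite -(cards1 u); apply: eq_card => w; rewrite !inE andbT.
  apply/setP => F; rewrite [RHS]inE; apply/flatsP/eqP => [[]|->].
    by move=> /subsetP F0 _; apply/setP => k; rewrite inE; apply/negP => /F0.
  by split; [apply/subsetP => k; rewrite inE|exists u; rewrite ?inE ?sub0set].
move=> us fam; have /andP [es us'] := us.
have famS x := slice_family x us fam.
pose fl x := flats s (slice P e x).
have flP x F : reflect
    (F \subset s /\ exists2 u, u \in slice P e x & F \subset zeros u) (F \in fl x).
  exact: flatsP.
have fl_e x F : F \in fl x -> e \notin F.
  by move=> /flP [/subsetP Fs _]; apply: contra es => /Fs.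
have zupd b u F : e \notin F -> F \subset zeros u -> F \subset zeros (upd u e b).
  move=> eF /subsetP Fz; apply/subsetP => k kF; rewrite inE ffunE ifN.
    by have := Fz k kF; rewrite inE.
  by apply: contraNneq eF => <-.
have flI : fl (Some true) :&: fl (Some false) = fl None.
  apply/setP => F; rewrite in_setI; apply/andP/idP => [[]|Fl].
    move=> /flP [Fs [u + Fu]] /flP [_ [w + Fw]].
    rewrite !in_slice => /andP [uP /eqP ue] /andP [wP /eqP we].
    have [t [tP te tE _]] := family_elim fam uP wP (mem_head _ _) ue we.
    apply/flP; split=> //; exists t; first by rewrite inE tP te /=.
    apply/subsetP => k kF; have := subsetP Fu k kF; have := subsetP Fw k kF.
    by rewrite !inE => /eqP wk /eqP uk; rewrite tE uk ?wk.
  have eF := fl_e _ _ Fl; have /flP [Fs [u uP Fu]] := Fl.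
  have flb b : F \in fl (Some b).
    apply/flP; split=> //; exists (upd u e (Some b)); last exact: zupd.
    exact: slice_refine fam uP.
  by split; exact: flb.
have -> : #|[set u in P | all (fun k => u k != None) (e :: s)]| =
    (#|fl (Some true)| + #|fl (Some false)|)%N.
  rewrite (card_slices _ P e) -!IHs // [X in (_ + X)%N]eq_card0 ?addn0.
    congr addn; apply: eq_card => u; rewrite !inE /=;
    by case: (u \in P) => //=; case: (u e) => [[]|].
  by move=> u; rewrite !inE /=; case: (u e) => [[]|]; rewrite ?andbF.
rewrite -cardsUI flI -[in RHS](cardsID [set F : {set 'I_n} | e \notin F]); congr addn.
  apply: eq_card => F; rewrite in_setU in_setI.
  apply/orP/andP => [FU|[/flatsP [/subsetP Fs [u uP Fu]]]]; last first.
    rewrite inE => eF.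
    have Fs' : F \subset s.
      apply/subsetP => k kF; move: (Fs k kF); rewrite inE.
      by case: eqP kF eF => // -> ->.
    case ue : (u e) => [b|].
      suff Fb : F \in fl (Some b) by case: b ue Fb; auto.
      by apply/flP; split=> //; exists u; rewrite // inE uP ue /=.
    left; apply/flP; split=> //; exists (upd u e (Some true)); last exact: zupd.
    by apply: (slice_refine true fam); rewrite inE uP ue /=.
  have [b Fb] : exists b, F \in fl (Some b) by case: FU; eexists; eassumption.
  split; last by rewrite inE (fl_e _ _ Fb).
  have /flP [/subsetP Fs [u + Fu]] := Fb; rewrite in_slice => /andP [uP _].
  apply/flatsP; split; last by exists u.
  by apply/subsetP => k /Fs; rewrite inE orbC => ->.
rewrite -(card_in_imset (f := fun F => e |: F) (D := fl None)); last first.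
  move=> F G /fl_e eF /fl_e eG /(congr1 (fun H => H :\ e)).
  by rewrite !setU1K.
apply: eq_card => F; apply/imsetP/setDP => [[G Gfl ->]|[/flatsP [/subsetP Fs [u uP Fu]]]].
  split; last by rewrite inE setU11.
  have /flP [/subsetP Gs [u + Gu]] := Gfl; rewrite in_slice => /andP [uP ue].
  apply/flatsP; split.
    by apply/subsetP => k /setU1P [->|/Gs]; rewrite inE ?eqxx // orbC => ->.
  by exists u => //; rewrite subUset Gu sub1set inE ue.
rewrite inE negbK => eF; exists (F :\ e); last by rewrite setD1K.
apply/flP; split.
  apply/subsetP => k; rewrite inE => /andP [+ /Fs]; rewrite inE.
  by rewrite inE => /negbTE ->.
exists u; last exact: subset_trans (subsetDl _ _) Fu.
by have := subsetP Fu e eF; rewrite !inE uP.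
Qed.

Lemma mdeg_side_label k x :
  mdeg (side_label va vb k x) = (1 + (x == None))%N.
Proof. by case: x => [[]|]; rewrite /side_label mdegD /= ?mdeg0 ?mdeg1. Qed.

Lemma mdeg_total u : mdeg (total u) = (n + #|zeros u|)%N.
Proof.
rewrite mdeg_sum; under eq_bigr do rewrite mdeg_side_label.
rewrite big_split /= sum1_size -cardE card_ord; congr addn.
by rewrite big_enum /= -sum1_card [RHS]big_mkcond;
  apply: eq_bigr => k _; rewrite inE; case: eqP.
Qed.

Lemma label_upd_le s u e b : u e = None ->
  (label s (upd u e (Some b)) <= label s u)%MM.
Proof.
move=> ue; apply/mnm_lepP => v; rewrite !mnm_sumE; apply: leq_sum => k _.
rewrite ffunE; case: eqP => [->|_] //; rewrite ue !mnmDE /=.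
by case: b; rewrite ?leq_addl ?leq_addr /= ?mnm0E ?addn0 ?leq_addr ?add0n ?leq_addl.
Qed.

Variables (P : {set sign_vector n}).
Hypothesis fam : sign_family (enum 'I_n) P.

(** Each refinement of a zero removes a variable from the label. *)
Lemma exists_chamber u : u \in P ->
  exists2 w, w \in [set w in P | zeros w == set0] & (total w <= total u)%MM.
Proof.
have [m] := ubnP #|zeros u|; elim: m => // m IHm in u * => zm uP.
have [z0|[e ez]] := set_0Vmem (zeros u).
  by exists u; rewrite ?lepm_refl // inE uP z0 /=.
have ue : u e = None by move: ez; rewrite inE => /eqP.
have u'P := family_refine fam true uP (mem_enum _ _) ue.
have [|w wP wu] := IHm _ _ u'P.
  apply: (leq_trans _ (zm : (#|zeros u| <= m)%N)); apply: proper_card.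
  apply/properP; split.
    by apply/subsetP => k; rewrite !inE ffunE; case: (k == e).
  by exists e; rewrite // inE ffunE eqxx.
by exists w => //; apply: lepm_trans wu (label_upd_le _ _ _).
Qed.

(** If two sign vectors without zeros were on different sides of an edge,
    elimination would give a label dividing their common label but of larger
    degree, the degree being n plus the number of zeros. *)
Lemma total_chamber_inj :
  {in [set u in P | zeros u == set0] &, injective total}.
Proof.
move=> u w; rewrite !inE => /andP [uP /eqP uz] /andP [wP /eqP wz] tuw.
have nosep u' w' e : u' \in P -> w' \in P -> zeros u' = set0 ->
    total u' = total w' -> u' e = Some true -> w' e = Some false -> False.
  move=> u'P w'P uz' tE u'e w'e.
  have [t [tP te _ tle]] := family_elim fam u'P w'P (mem_enum _ _) u'e w'e.
  have : (total t <= total u')%MM.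
    by apply/mnm_lepP => v; have := tle v; rewrite -tE maxnn.
  move/lem_mdeg; rewrite !mdeg_total uz' cards0 leq_add2l leqn0 cards_eq0.
  by move=> /eqP /setP /(_ e); rewrite !inE te.
apply/ffunP => e.
have nz u' : zeros u' = set0 -> u' e != None.
  by move=> /setP/(_ e); rewrite !inE => /negbT.
case ue: (u e) (nz u uz) => [[]|] //; case we: (w e) (nz w wz) => [[]|] // _ _.
- by case: (nosep u w e).
- by case: (nosep w u e).
Qed.

Variable K : fieldType.
Local Notation S := {mpoly K[N]}.
Variable I : S -> Prop.
Hypothesis IE : forall p, I p <-> family_ideal va vb (enum 'I_n) P p.

Lemma family_minimal_generators :
  number_of_minimal_generators I
    #|[set F : {set 'I_n} | [exists u in P, F \subset zeros u]]|.
Proof.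
pose ch := [set u in P | zeros u == set0].
have -> : #|[set F : {set 'I_n} | [exists u in P, F \subset zeros u]]| =
    size [seq total u | u <- enum ch].
  rewrite size_map -cardE.
  have -> : ch = [set u in P | all (fun k => u k != None) (enum 'I_n)].
    apply/setP => u; rewrite !inE; congr andb; apply/eqP/allP => [/setP z k _|z].
      by have := z k; rewrite !inE => /negbT.
    by apply/setP => k; rewrite !inE (negbTE (z k _)) ?mem_enum.
  rewrite card_chambers ?enum_uniq //; apply: eq_card => F; rewrite !inE.
  by rewrite [X in X && _](_ : _ = true) //; apply/subsetP => k _; rewrite mem_enum.
apply: (@equigenerated_minimal_generators _ _ _ n).
- rewrite map_inj_in_uniq ?enum_uniq // => u w; rewrite !mem_enum.
  exact: total_chamber_inj.
- move=> _ /mapP [u + ->]; rewrite mem_enum inE => /andP [_ /eqP uz].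
  by rewrite mdeg_total uz cards0 addn0.
move=> p; rewrite IE; split; apply: monomial_ideal_sub => m.
  move=> [u /exists_chamber [w wch wu] ->]; exists (total w) => //.
  by rewrite map_f ?mem_enum.
move=> /mapP [u + ->]; rewrite mem_enum inE => /andP [uP _].
by exists (total u); rewrite ?lepm_refl //; exists u.
Qed.

Lemma family_highest_syzygy D :
  {in P, forall u, #|zeros u| <= D}%N ->
  (exists2 u, u \in P & #|zeros u| = D) ->
  highest_syzygy_rank I #|[set u in P | #|zeros u| == D]|.
Proof.
move=> leD [u0 u0P u0D].
have [C [linC rkC]] := family_resolution K (enum_uniq _) fam.
have {}rkC i : rk C i = #|[set u in P | #|zeros u| == i]|.
  rewrite rkC; apply: eq_card => u; rewrite !inE; congr (_ && (_ == _)).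
  rewrite -sum1_count big_enum_cond /= -sum1_card.
  by apply: eq_bigl => k; rewrite inE.
have resC : resolves C I.
  by case: linC => -[inC exC0 exC] _ _; split=> // p; rewrite IE.
split; first by exists C; split; [|exact: linear_graded linC|exact: linear_minimal linC].
move=> C' [resC' _ minC'].
have E := minimal_rank_unique resC' resC minC' (linear_minimal linC).
exists D; split=> [|i Di|]; rewrite E rkC //.
  by apply/card_gt0P; exists u0; rewrite inE u0P u0D /=.
apply: eq_card0 => u; rewrite !inE; apply/negbTE/negP => /andP [/leD uD /eqP ui].
by rewrite leqNgt ui Di in uD.
Qed.

End Invariants.

(** * Forests, cuts and cycles *)

Section Graphs.
Variables (d n : nat) (G : 'I_n -> {set 'I_d}) (src dst : 'I_n -> 'I_d).
Hypothesis GE : forall k, G k = [set src k; dst k].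
Hypothesis loopless : forall k, src k != dst k.
Implicit Types (F : {set 'I_n}) (i j : 'I_d) (c : seq ('I_d * 'I_n)).

Local Notation step := (fun x y : 'I_d * 'I_n => G x.2 == [set x.1; y.1]).

Lemma acyclicS F F' : F' \subset F -> acyclic G F -> acyclic G F'.
Proof.
move=> F'F; apply: contra => /existsP [m /existsP [c /andP [cyc cF]]].
apply/existsP; exists m; apply/existsP; exists c; rewrite cyc /=.
by apply/allP => x /(allP cF) /(subsetP F'F).
Qed.

Lemma acyclicPn F c : is_cycle G c -> all (fun x => x.2 \in F) c ->
  c != [::] -> ~~ acyclic G F.
Proof.
move=> cyc cF; case: c cyc cF => // x c cyc cF _; rewrite negbK.
have sz : (size c < d)%N.
  have /and3P [_ /card_uniqP /= us _] := cyc.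
  have := max_card (mem (map fst (x :: c))).
  by rewrite card_ord us /= size_map.
apply/existsP; exists (Ordinal sz); apply/existsP => /=.
by exists (@Tuple _ _ (x :: c) (eqxx _)); rewrite cyc.
Qed.

(** A simple path in F closes up with an edge e outside F.  The edges chosen along
    the path are distinct because the later ones avoid x. *)
Lemma close_path F x p e y : path (adjacent G F) x p -> uniq (x :: p) ->
  G e = [set last x p; y] -> e \notin F ->
  exists e0 c, [/\ map fst c = p, uniq (e0 :: map snd c),
    {in e0 :: map snd c, forall k, k = e \/ k \in F /\ G k \subset x :: p}
    & forall f, path step (x, e0) (rcons c (y, f))].
Proof.
elim: p x => [|z p IHp] x /=.
  move=> _ _ Ge _; exists e, [::]; split=> //= [k|f].
    by rewrite inE => /eqP ->; left.
  by rewrite Ge eqxx.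
move=> /andP [/existsP [k /andP [kF /eqP Gk]] zp] /andP [xzp uzp] Ge eF.
have [e0 [c [cp uc inF pc]]] := IHp z zp uzp Ge eF.
exists k, ((z, e0) :: c); split=> /=; first by rewrite cp.
- rewrite -/(uniq (e0 :: map snd c)) uc andbT; apply/negP => kc.
  have [ke|[_ /subsetP Gs]] := inF k kc; first by rewrite -ke kF in eF.
  by move/negP: xzp; apply; apply: Gs; rewrite Gk !inE eqxx.
- move=> l; rewrite inE => /predU1P [->|/inF [|[lF Gl]]]; [right|by left|right].
    by split=> //; rewrite Gk; apply/subsetP => v /set2P [] ->; rewrite !inE eqxx ?orbT.
  split=> //; apply: subset_trans Gl _.
  by apply/subsetP => v vz; rewrite inE; apply/orP; right.
by move=> f; rewrite Gk eqxx; exact: pc.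
Qed.

(** A simple path joining the ends of e would close up with e to a cycle. *)
Lemma acyclic_separated F e : acyclic G F -> e \in F ->
  ~~ connect (adjacent G (F :\ e)) (src e) (dst e).
Proof.
move=> acF eF; apply/negP => /connectP [q /shortenP [p xp up _]] pE.
have [||e0 [c [cp uc inF pc]]] := close_path (e := e) (y := src e) xp up.
- by rewrite -pE GE setUC.
- by rewrite !inE eqxx.
suff : ~~ acyclic G F by rewrite acF.
apply: (@acyclicPn F ((src e, e0) :: c)) => //.
  by apply/and3P; split=> //=; rewrite ?cp //; exact: pc.
apply/allP => y yc.
have : y.2 \in e0 :: map snd c by apply: (map_f snd yc).
by move=> /inF [->//|[]]; rewrite inE => /andP [].
Qed.

Lemma adjacent_edge F k : k \in F -> adjacent G F (src k) (dst k).
Proof. by move=> kF; apply/existsP; exists k; rewrite kF GE eqxx. Qed.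

Lemma adjacent_sym F : ssrbool.symmetric (adjacent G F).
Proof. by move=> i j; apply: eq_existsb => k; rewrite setUC. Qed.

Lemma connect_edge F i k : k \in F ->
  connect (adjacent G F) i (src k) = connect (adjacent G F) i (dst k).
Proof.
move=> kF; apply/idP/idP => ij; apply: connect_trans ij (connect1 _).
  exact: adjacent_edge.
by rewrite adjacent_sym; exact: adjacent_edge.
Qed.

Lemma connect_invariant (T : Type) F (g : 'I_d -> T) i j :
  {in F, forall k, g (src k) = g (dst k)} -> connect (adjacent G F) i j ->
  g i = g j.
Proof.
move=> gF /connectP [p + ->]; elim: p i => [|z p IHp] i //=.
move=> /andP [/existsP [k /andP [kF /eqP Gk]] zp]; rewrite -(IHp z zp).
move: Gk; rewrite GE => /setP E.
have := gF k kF; have := E i; have := E z.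
rewrite !inE !eqxx ?orbT => /orP zE /orP iE gk.
by case: iE zE => /eqP -> [] /eqP ->.
Qed.

Section Weights.
Variable R : realFieldType.

(** Indicator function of one side of the cut that e defines in a forest.
    These functions are dual to the edges of the forest ([cut_edge]) and replace
    the linear independence of their incidence vectors. *)
Definition cut F e i : R := (connect (adjacent G (F :\ e)) (src e) i)%:R.

Lemma cut_edge F e k : acyclic G F -> e \in F -> k \in F ->
  cut F e (src k) - cut F e (dst k) = (k == e)%:R.
Proof.
move=> acF eF kF; rewrite /cut; case: eqP => [->|/eqP ke].
  by rewrite connect0 (negbTE (acyclic_separated acF eF)) subr0.
by rewrite (connect_edge _ (k := k)) ?subrr // !inE ke.
Qed.

Definition incidence k i : R := (src k == i)%:R - (dst k == i)%:R.

Lemma incidence_sum k (g : 'I_d -> R) :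
  \sum_i incidence k i * g i = g (src k) - g (dst k).
Proof.
under eq_bigr do rewrite mulrBl.
rewrite sumrB (bigD1 (src k)) //= eqxx mul1r big1 ?addr0; last first.
  by move=> i /negbTE; rewrite eq_sym => ->; rewrite mul0r.
rewrite (bigD1 (dst k)) //= eqxx mul1r big1 ?addr0 //.
by move=> i /negbTE; rewrite eq_sym => ->; rewrite mul0r.
Qed.

Lemma step_incidence x y v : step x y ->
  (if x.1 == src x.2 then 1 else -1) * incidence x.2 v =
    (x.1 == v)%:R - (y.1 == v)%:R.
Proof.
case: x y => x e [y f] /=; rewrite GE => /eqP/setP E; rewrite /incidence.
have : src e \in [set x; y] by rewrite -[_ \in _]E !inE eqxx.
have : dst e \in [set x; y] by rewrite -[_ \in _]E !inE eqxx orbT.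
have : x \in [set src e; dst e] by rewrite [_ \in _]E !inE eqxx.
have := loopless e; rewrite !inE.
have [->|xs] /= := eqVneq x (src e).
  by rewrite eq_sym => /negbTE -> _ /= /eqP -> _; rewrite mul1r.
by move=> _ /eqP -> _ /eqP ->; rewrite mulN1r opprB.
Qed.

(** Orient the edges along a cycle: the signed incidence vectors telescope. *)
Lemma cycle_dependency F : ~~ acyclic G F ->
  exists w : 'I_n -> R, [/\ exists k, w k != 0, forall k, w k != 0 -> k \in F
    & forall v, \sum_k w k * incidence k v = 0].
Proof.
rewrite negbK => /existsP [m /existsP [[c sc] /= /andP [cyc cF]]].
case: c sc cyc cF => // x c _ /and3P [cyc _ uc] cF.
pose s (y : 'I_d * 'I_n) : R := if y.1 == src y.2 then 1 else -1.
exists (fun k => \sum_(y <- x :: c | y.2 == k) s y); split.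
- exists x.2; rewrite big_cons eqxx big1_seq ?addr0.
    by rewrite /s; case: ifP; rewrite ?oppr_eq0 oner_eq0.
  move=> y /andP [/eqP yx yc]; move: uc => /= /andP [/negP []].
  by rewrite -yx map_f.
- move=> k; apply: contraR => kF; rewrite big1_seq // => y /andP [/eqP yk yc].
  by have := allP cF _ yc; rewrite yk (negbTE kF).
move=> v; under eq_bigr do rewrite big_distrl /=.
rewrite (exchange_big_dep predT) //=.
under eq_bigr => y _.
  rewrite (big_pred1 y.2) => [|k]; last by rewrite /= eq_sym.
  over.
have telescope z p : path step z p ->
    \sum_(y <- belast z p) s y * incidence y.2 v =
    (z.1 == v)%:R - ((last z p).1 == v)%:R.
  elim: p z => [|t p IHp] z /=; first by rewrite big_nil subrr.
  move=> /andP [zt tp]; rewrite big_cons IHp // (step_incidence _ zt).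
  by rewrite addrA subrK.
have := telescope _ _ cyc; rewrite belast_rcons last_rcons subrr.
exact.
Qed.

Section ForestSize.
Hypothesis d_gt0 : (0 < d)%N.
Variable F : {set 'I_n}.
Hypothesis acF : acyclic G F.
Let i0 : 'I_d := Ordinal d_gt0.

(* The incidence matrix of F, with a row that pins the value at i0. *)
Let B : 'M[R]_(#|F| + 1, d) :=
  col_mx (\matrix_(r, i) incidence (enum_val r) i) (delta_mx 0 i0).

Let mulB (g : 'cV[R]_d) : B *m g = 0 <->
  {in F, forall k, g (src k) 0 = g (dst k) 0} /\ g i0 0 = 0.
Proof.
rewrite mul_col_mx -rowE; split=> [|[gF g0]].
  rewrite -[X in _ = X]col_mx0 => /eq_col_mx [/matrixP Bg /matrixP/(_ 0 0)].
  rewrite !mxE => ->; split=> // k kF; apply/eqP; rewrite -subr_eq0; apply/eqP.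
  have := Bg (enum_rank_in kF k) 0; rewrite !mxE => <-.
  rewrite -(incidence_sum k (fun i => g i 0)); apply: eq_bigr => i _.
  by rewrite mxE enum_rankK_in.
rewrite -[X in _ = X]col_mx0; congr col_mx; apply/matrixP => r j; rewrite !ord1 !mxE //.
under eq_bigr do rewrite mxE.
by rewrite (incidence_sum _ (fun i => g i 0)) gF ?subrr // enum_valP.
Qed.

(* The cut functions, shifted to vanish at i0, and the constant function 1 form
   a right inverse. *)
Let B_free : row_free B.
Proof.
pose X : 'M[R]_(d, #|F|) :=
  \matrix_(i, r) (cut F (enum_val r) i - cut F (enum_val r) i0).
apply/row_freeP; exists (row_mx X (const_mx 1)).
rewrite mul_col_row scalar_mx_block; congr block_mx; apply/matrixP => r j.
- rewrite !mxE; under eq_bigr do rewrite !mxE.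
  rewrite (incidence_sum _ (fun i => cut F (enum_val j) i - cut F (enum_val j) i0)).
  rewrite opprB addrA subrK cut_edge ?enum_valP //.
  by rewrite (inj_eq enum_val_inj).
- rewrite !mxE; under eq_bigr do rewrite !mxE.
  by rewrite (incidence_sum _ (fun=> 1)) subrr.
- by rewrite -rowE !mxE subrr.
by rewrite -rowE !mxE !ord1 eqxx.
Qed.

Lemma forest_size : (#|F| < d)%N.
Proof. by rewrite -addn1 -(eqP B_free) rank_leq_col. Qed.

(** The incidence matrix pinned at i0 has independent rows; it is square exactly
    when the functions constant along F are constant, that is, when F connects
    all vertices. *)
Lemma forest_spanning : connected_by G F = (#|F|.+1 == d).
Proof.
rewrite /connected_by d_gt0 /=; apply/idP/eqP => [/forallP conF|dF].
  apply/eqP; rewrite eqn_leq forest_size /= -addn1.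
  suff /eqP <- : row_free B^T by rewrite mxrank_tr rank_leq_row.
  apply: inj_row_free => v vB.
  have /mulB [vF v0] : B *m v^T = 0 by rewrite -[B]trmxK -trmx_mul vB trmx0.
  apply/rowP => i; rewrite mxE.
  have := connect_invariant (g := fun i => v^T i 0) vF (forallP (conF i) i0).
  by rewrite v0 mxE.
have /row_fullP [Y YB] : row_full B by rewrite /row_full (eqP B_free) addn1 dF.
apply/forallP => i.
pose g : 'cV[R]_d := \col_j ((connect (adjacent G F) i j)%:R
                             - (connect (adjacent G F) i i0)%:R).
have g0 : g = 0.
  rewrite -[g]mul1mx -YB -mulmxA (_ : B *m g = 0) ?mulmx0 //.
  by apply/mulB; split=> [k kF|]; rewrite !mxE ?subrr // (connect_edge _ kF).
have cE j : connect (adjacent G F) i j = connect (adjacent G F) i i0.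
  have /matrixP/(_ j 0)/eqP := g0; rewrite !mxE subr_eq0 eqr_nat.
  by do 2 case: (connect _ _ _).
by apply/forallP => j; rewrite cE -(cE i) connect0.
Qed.

End ForestSize.
End Weights.
End Graphs.

(** * Affine graphic arrangements *)

Section Arrangement.
Variables (R : realType) (d n : nat) (G : 'I_n -> {set 'I_d}).
Variables (src dst : 'I_n -> 'I_d) (c : 'I_n -> R).
Hypothesis GE : forall k, G k = [set src k; dst k].
Hypothesis loopless : forall k, src k != dst k.
Implicit Types (p q r : 'rV[R]_d) (F : {set 'I_n}).

Definition gap p k : R := p 0 (src k) - p 0 (dst k) - c k.

Definition sign_of p : sign_vector n :=
  [ffun k => if gap p k == 0 then None else Some (0 < gap p k)].

Definition covectors : {set sign_vector n} :=
  [set u | `[< exists p, sign_of p = u >]].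

Lemma covectorsP u : reflect (exists p, sign_of p = u) (u \in covectors).
Proof. by rewrite inE; exact: asboolP. Qed.

Lemma sign_of_covector p : sign_of p \in covectors.
Proof. by apply/covectorsP; exists p. Qed.

Lemma sign_of_eq0 p k : (sign_of p k == None) = (gap p k == 0).
Proof. by rewrite ffunE; case: (gap p k == 0). Qed.

Lemma sign_of_ge0 p k : (sign_of p k != Some false) = (0 <= gap p k).
Proof. by rewrite ffunE; case: ltrgt0P. Qed.

Lemma sign_of_le0 p k : (sign_of p k != Some true) = (gap p k <= 0).
Proof. by rewrite ffunE; case: ltrgt0P. Qed.

Lemma sign_of_gt0 p k : (sign_of p k == Some true) = (0 < gap p k).
Proof. by rewrite ffunE; case: ltrgt0P. Qed.

Lemma sign_of_lt0 p k : (sign_of p k == Some false) = (gap p k < 0).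
Proof. by rewrite ffunE; case: ltrgt0P. Qed.

Lemma eq_sign_of p q k :
  (0 <= gap p k) = (0 <= gap q k) -> (gap p k <= 0) = (gap q k <= 0) ->
  sign_of p k = sign_of q k.
Proof.
rewrite !ffunE.
by case: (ltrgt0P (gap p k)) => _; case: (ltrgt0P (gap q k)) => _.
Qed.

(** The point is the coordinatewise maximum of p and q + t, with t chosen such
    that the maximum is attained by p at src e and by q + t at dst e, with the
    prescribed difference.  In a coordinate i where it is attained by p, every
    hyperplane that has the new point in its i-th sector has p there too. *)
Lemma tropical_segment p q e : 0 < gap p e -> gap q e < 0 ->
  exists r, [/\ gap r e = 0,
    forall k, sign_of p k = sign_of q k -> sign_of r k = sign_of p k
  & forall i, (forall k, (src k = i -> 0 <= gap r k -> 0 <= gap p k) /\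
                         (dst k = i -> gap r k <= 0 -> gap p k <= 0)) \/
              (forall k, (src k = i -> 0 <= gap r k -> 0 <= gap q k) /\
                         (dst k = i -> gap r k <= 0 -> gap q k <= 0))].
Proof.
rewrite /gap => pe qe; pose t := p 0 (src e) - c e - q 0 (dst e).
pose r := \row_i Num.max (p 0 i) (q 0 i + t).
have rE i : r 0 i = Num.max (p 0 i) (q 0 i + t) by rewrite mxE.
have rp i : p 0 i <= r 0 i by rewrite rE le_max lexx.
have rq i : q 0 i + t <= r 0 i by rewrite rE le_max lexx orbT.
have rpq i : r 0 i = p 0 i \/ r 0 i = q 0 i + t.
  by rewrite rE; case: leP; auto.
exists r; split.
- have -> : r 0 (src e) = p 0 (src e) by rewrite rE; apply/max_idPl; rewrite /t; lra.
  have -> : r 0 (dst e) = q 0 (dst e) + t by rewrite rE; apply/max_idPr; rewrite /t; lra.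
  by rewrite /t; lra.
- move=> k pqk; have pq0 := sign_of_ge0 p k; have pq1 := sign_of_le0 p k.
  rewrite pqk sign_of_ge0 in pq0; rewrite pqk sign_of_le0 in pq1.
  move: pq0 pq1; rewrite /gap => pq0 pq1; apply: eq_sign_of; rewrite /gap.
    apply/idP/idP => H.
      case: (rpq (src k)) => E; first by have := rp (dst k); lra.
      by rewrite -pq0; have := rq (dst k); lra.
    case: (rpq (dst k)) => E; first by have := rp (src k); lra.
    by have := rq (src k); rewrite -pq0 in H; lra.
  apply/idP/idP => H.
    case: (rpq (dst k)) => E; first by have := rp (src k); lra.
    by rewrite -pq1; have := rq (src k); lra.
  case: (rpq (src k)) => E; first by have := rp (dst k); lra.
  by have := rq (dst k); rewrite -pq1 in H; lra.
move=> i; case: (rpq i) => E; [left|right] => k; split=> ki; rewrite /gap ki E.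
- by have := rp (dst k); lra.
- by have := rp (src k); lra.
- by have := rq (dst k); lra.
- by have := rq (src k); lra.
Qed.

Lemma gap_shift p (g : 'I_d -> R) t k :
  gap (p + \row_i (t * g i)) k = gap p k + t * (g (src k) - g (dst k)).
Proof. by rewrite /gap !mxE; lra. Qed.

Lemma exists_small (I : finType) (f : I -> R) :
  exists2 eps, 0 < eps & forall k, f k != 0 -> eps < `|f k|.
Proof.
pose m := \big[Num.min/1]_(k | f k != 0) `|f k|.
have m_gt0 : 0 < m by apply: lt_bigmin => // k fk; rewrite normr_gt0.
exists (m / 2) => [|k fk]; first by lra.
have : m <= `|f k| by apply: bigmin_le_cond.
by lra.
Qed.

Hypothesis acyclic_zeros : forall p, acyclic G (zeros (sign_of p)).

(** Moving p along the cut function of e within the forest of its hyperplanes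
    leaves all of them except e unchanged; a small move keeps the other signs. *)
Lemma covector_refine u e b :
  u \in covectors -> u e = None -> upd u e (Some b) \in covectors.
Proof.
move=> /covectorsP [p <-] /eqP pe.
pose F := zeros (sign_of p); have eF : e \in F by rewrite inE.
have [eps eps_gt0 epsP] := exists_small (gap p).
pose t := if b then eps else - eps.
have te : `|t| = eps by rewrite /t; case: (b); rewrite ?normrN gtr0_norm.
apply/covectorsP; exists (p + \row_i (t * cut G src R F e i)).
apply/ffunP => k; rewrite !ffunE gap_shift.
have [kF|kF] := boolP (k \in F).
  have := kF; rewrite inE sign_of_eq0 => /eqP ->.
  rewrite add0r (cut_edge GE R (acyclic_zeros p) eF kF).
  have [_|ke] := eqVneq k e; last by rewrite mulr0 eqxx.
  rewrite mulr1 /t; case: (b) => /=.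
    by rewrite gt_eqF // eps_gt0.
  by rewrite lt_eqF ?oppr_lt0 // oppr_gt0 ltNge ltW.
have -> : (k == e) = false by apply: contraNF kF => /eqP ->.
move: kF; rewrite inE sign_of_eq0 => pk.
set h := _ - _; have h1 : `|h| <= 1.
  by rewrite /h /cut; do 2 case: (connect _ _ _); rewrite ler_norml /=; lra.
have : `|t * h| < `|gap p k|.
  rewrite normrM te; apply: le_lt_trans (epsP k pk).
  by rewrite ler_piMr // ltW.
rewrite (negbTE pk); move: pk; case: (ltrgt0P (gap p k)) => // gk _.
  rewrite ltr_norml => /andP [h2 h3].
  have h4 : 0 < gap p k + t * h by lra.
  by rewrite gt_eqF // h4.
rewrite ltr_norml => /andP [h2 h3].
have h4 : gap p k + t * h < 0 by lra.
by rewrite lt_eqF // ltNge ltW.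
Qed.

(** The cut functions solve the system of equations of the hyperplanes in F. *)
Lemma forest_flat F : acyclic G F -> exists p, F \subset zeros (sign_of p).
Proof.
move=> acF; exists (\row_i \sum_(e in F) c e * cut G src R F e i).
apply/subsetP => k kF; rewrite inE sign_of_eq0 /gap !mxE -sumrB.
rewrite (eq_bigr (fun e => c e * (k == e)%:R)) => [|e eF]; last first.
  by rewrite -mulrBr (cut_edge GE R acF eF kF).
rewrite (bigD1 k) //= eqxx mulr1 big1 ?addr0 ?subrr // => e /andP [_ /negbTE].
by rewrite eq_sym => ->; rewrite mulr0.
Qed.

Lemma forestsE :
  [set F : {set 'I_n} | [exists u in covectors, F \subset zeros u]] = forests G.
Proof.
apply/setP => F; rewrite !inE; apply/exists_inP/idP => [[u]|acF].
  by move=> /covectorsP [p <-] Fp; exact: acyclicS Fp (acyclic_zeros p).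
have [p Fp] := forest_flat acF.
by exists (sign_of p) => //; exact: sign_of_covector.
Qed.

Hypothesis connG : connected_graph G.

Let d_gt0 : (0 < d)%N.
Proof. by case/andP: connG. Qed.

Lemma card_zeros_le u : u \in covectors -> (#|zeros u| <= d.-1)%N.
Proof.
move=> /covectorsP [p <-]; rewrite -ltnS prednK //.
exact: (forest_size GE R d_gt0 (acyclic_zeros p)).
Qed.

Lemma acyclic_connected F : acyclic G F -> connected_by G F = (#|F| == d.-1).
Proof.
by move=> acF; rewrite (forest_spanning GE R d_gt0 acF) -{1}(prednK d_gt0) eqSS.
Qed.

(** Take a point on a maximal number of hyperplanes.  If these did not connect
    the vertices, the point could be moved along the indicator function of a
    component, staying on them, until it meets an edge leaving the component. *)
Lemma exists_vertex : exists2 u, u \in covectors & #|zeros u| = d.-1.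
Proof.
have [u /covectorsP [p pu] umax] :=
  arg_maxnP (fun u : sign_vector n => #|zeros u|) (sign_of_covector 0).
exists u; first by apply/covectorsP; exists p.
apply/eqP; rewrite -acyclic_connected; last by rewrite -pu; exact: acyclic_zeros.
rewrite /connected_by d_gt0 /=; apply/forallP => i; apply/forallP => j.
apply/negPn/negP => nij; pose F := zeros u.
pose g v : R := (connect (adjacent G F) i v)%:R.
have [k kg] : exists k, g (src k) != g (dst k).
  apply/existsP; rewrite -[X in is_true X]negbK; apply/negP => /existsPn gk.
  have gG : {in setT, forall k, g (src k) = g (dst k)}.
    by move=> k _; apply/eqP; have := gk k; rewrite negbK.
  have /andP [_ /forallP /(_ i) /forallP /(_ j)] := connG.
  move=> /(connect_invariant GE gG); rewrite /g connect0 (negbTE nij) => /eqP.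
  by rewrite oner_eq0.
have gF l : l \in F -> g (src l) = g (dst l).
  by move=> lF; rewrite /g (connect_edge GE i lF).
have kF : k \notin F by apply: contraNN kg => /gF ->.
pose t := - gap p k / (g (src k) - g (dst k)).
have /umax : sign_of (p + \row_v (t * g v)) \in covectors := sign_of_covector _.
suff /subset_leq_card : k |: F \subset zeros (sign_of (p + \row_v (t * g v))).
  by rewrite cardsU1 kF => h1 h2; have := leq_trans h1 h2; rewrite ltnn.
rewrite subUset sub1set inE sign_of_eq0 gap_shift {1}/t divfK ?subr_eq0 // eqxx /=.
apply/subsetP => l lF; rewrite inE sign_of_eq0 gap_shift (gF l lF) subrr mulr0.
by move: lF; rewrite addr0 /F -pu inE sign_of_eq0.
Qed.

(** A connected set of hyperplanes determines p up to adding a constant vector,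
    hence it determines the sign vector. *)
Lemma card_vertices :
  #|[set u in covectors | #|zeros u| == d.-1]| = #|spanning_trees G|.
Proof.
rewrite -(card_in_imset (f := @zeros n)).
  apply: eq_card => F; rewrite [RHS]inE; apply/imsetP/andP.
    move=> [u]; rewrite inE => /andP [/covectorsP [p <-] pd] ->.
    by rewrite acyclic_connected ?pd acyclic_zeros.
  move=> [acF]; rewrite acyclic_connected // => Fd.
  have [p Fp] := forest_flat acF; exists (sign_of p).
    by rewrite inE sign_of_covector eqn_leq card_zeros_le ?sign_of_covector //
       -(eqP Fd) subset_leq_card.
  apply/eqP; rewrite eqEcard Fp (eqP Fd) card_zeros_le //.
  exact: sign_of_covector.
move=> u w; rewrite !inE => /andP [/asboolP [p <-] pd] /andP [/asboolP [q <-] qd] pq.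
have := acyclic_connected (acyclic_zeros p); rewrite pd.
move=> /andP [_ /forallP /(_ (src _))/forallP con].
have gE : {in zeros (sign_of p), forall k,
    p 0 (src k) - q 0 (src k) = p 0 (dst k) - q 0 (dst k)}.
  move=> k kp; have := kp; rewrite pq; move: kp.
  by rewrite !inE !sign_of_eq0 /gap => /eqP h1 /eqP h2; lra.
have gapE k : gap p k = gap q k.
  have := connect_invariant (g := fun i => p 0 i - q 0 i) GE gE (con k (dst k)).
  by rewrite /gap /=; lra.
by apply/ffunP => k; rewrite !ffunE gapE.
Qed.

(** A variable belongs to a single row, its value under [row]: this is what the
    fine variables and the coarse variables have in common. *)
Section Labels.
Variables (N : nat) (va vb : 'I_n -> 'I_N) (row : 'I_N -> 'I_d).
Hypothesis rowa : forall k, row (va k) = src k.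
Hypothesis rowb : forall k, row (vb k) = dst k.

Lemma side_labelE k x v : side_label va vb k x v =
  (((x != Some false) && (va k == v)) + ((x != Some true) && (vb k == v)))%N.
Proof.
by rewrite /side_label; case: x => [[]|]; rewrite mnmDE ?mnm0E ?mnm1E.
Qed.

Lemma covectors_family : sign_family va vb (enum 'I_n) covectors.
Proof.
split=> [u e b uL _||u w e _ _]; first exact: covector_refine.
  move=> _ _ e /covectorsP [p <-] /covectorsP [q <-] _ /eqP + /eqP.
  rewrite sign_of_gt0 sign_of_lt0 => pe qe.
  have [r [re rpq rle]] := tropical_segment pe qe.
  exists (sign_of r); split=> // [|| v]; first exact: sign_of_covector.
    by apply/eqP; rewrite sign_of_eq0 re.
  have bound q' : (forall k, (src k = row v -> 0 <= gap r k -> 0 <= gap q' k) /\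
      (dst k = row v -> gap r k <= 0 -> gap q' k <= 0)) ->
      (label va vb (enum 'I_n) (sign_of r) v <=
       label va vb (enum 'I_n) (sign_of q') v)%N.
    move=> rq'; rewrite !mnm_sumE; apply: leq_sum => k _; rewrite !side_labelE.
    have [h1 h2] := rq' k; rewrite !sign_of_ge0 !sign_of_le0; apply: leq_add.
      case: (va k =P v) => [vk|_]; rewrite ?andbF // !andbT.
      have /h1 : src k = row v by rewrite -vk rowa.
      by case: (0 <= gap r k) => // ->.
    case: (vb k =P v) => [vk|_]; rewrite ?andbF // !andbT.
    have /h2 : dst k = row v by rewrite -vk rowb.
    by case: (gap r k <= 0) => // ->.
  by rewrite leq_max; case: (rle (row v)) => /bound ->; rewrite ?orbT.
by rewrite mem_enum.
Qed.

End Labels.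
End Arrangement.

(** * Generic heights give acyclic incidences *)

Section Simplices.
Variable R : realType.

Lemma conv_vertex (I : finType) m (P : pred I) (v : I -> 'rV[R]_m) i :
  P i -> conv P v (v i).
Proof.
move=> Pi; exists (fun j => (j == i)%:R); split.
- by move=> j; rewrite ler0n.
- by move=> j; apply: contraNeq; rewrite pnatr_eq0 eqb0 negbK => /eqP ->.
- by rewrite (bigD1 i) //= eqxx big1 ?addr0 // => j /negbTE ->.
by rewrite (bigD1 i) //= eqxx scale1r big1 ?addr0 // => j /negbTE ->; rewrite scale0r.
Qed.

(** Write x as a convex combination of the vertices.  A vertex with positive
    weight must attain the maximum of f, which only x does. *)
Lemma simplex_exposed_vertex m r (v : 'I_r -> 'rV[R]_m) x (f : 'cV[R]_m) :
  conv predT v x -> (forall z, conv predT v z -> (z *m f) 0 0 <= (x *m f) 0 0) ->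
  (forall z, conv predT v z -> (z *m f) 0 0 = (x *m f) 0 0 -> z = x) ->
  exists s, v s = x.
Proof.
move=> [w [w0 _ w1 xE]] xmax xuniq.
have vin s : conv predT v (v s) by exact: conv_vertex.
have sum0 : \sum_s w s * ((x *m f) 0 0 - (v s *m f) 0 0) = 0.
  under eq_bigr do rewrite mulrBr; rewrite sumrB -mulr_suml w1 mul1r {1}xE.
  rewrite mulmx_suml summxE -sumrB big1 // => s _.
  by rewrite -scalemxAl mxE subrr.
have [s ws] : exists s, w s != 0.
  apply/existsP; rewrite -[X in is_true X]negbK; apply/negP => /existsPn ws.
  move: w1; rewrite big1 => [/eqP|s _]; first by rewrite eq_sym oner_eq0.
  by apply/eqP; have := ws s; rewrite negbK.
exists s; apply: xuniq => //; apply/eqP; rewrite eq_sym -subr_eq0.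
have /allP/(_ s) : all (fun s => w s * ((x *m f) 0 0 - (v s *m f) 0 0) == 0) (enum 'I_r).
  have := psumr_eq0P (P := xpredT) (F := fun s => w s * ((x *m f) 0 0 - (v s *m f) 0 0)).
  move=> H; apply/allP => t _; apply/eqP; apply: H => // u _.
  by rewrite mulr_ge0 // subr_ge0 xmax.
by rewrite mem_enum mulf_eq0 (negbTE ws); exact.
Qed.

(** Such points are distinct vertices of the simplex, hence affinely
    independent. *)
Lemma simplex_exposed_independent m (X : 'rV[R]_m -> Prop) (T : finType)
    (x : T -> 'rV[R]_m) (f : T -> 'cV[R]_m) (w : T -> R) :
  is_simplex X -> injective x ->
  (forall t, w t != 0 ->
     [/\ X (x t), forall z, X z -> (z *m f t) 0 0 <= (x t *m f t) 0 0
       & forall z, X z -> (z *m f t) 0 0 = (x t *m f t) 0 0 -> z = x t]) ->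
  \sum_t w t = 0 -> \sum_t w t *: x t = 0 -> forall t, w t = 0.
Proof.
move=> [r [v [affv XE]]] injx expx w0 wx0 t.
apply/eqP/negPn/negP => wt.
have /fin_all_exists [s sE] : forall u, exists s : 'I_r, w u != 0 -> v s = x u.
  move=> u; have [Xt xmax xuniq] := expx t wt.
  have [wu|_] := boolP (w u != 0); last first.
    have [s _] := simplex_exposed_vertex ((XE _).1 Xt)
      (fun z vz => xmax z ((XE _).2 vz)) (fun z vz => xuniq z ((XE _).2 vz)).
    by exists s.
  have {Xt xmax xuniq} [Xu xmax xuniq] := expx u wu.
  have [s sE] := simplex_exposed_vertex ((XE _).1 Xu)
    (fun z vz => xmax z ((XE _).2 vz)) (fun z vz => xuniq z ((XE _).2 vz)).
  by exists s.
pose c a := \sum_(u | s u == a) w u.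
have c0 : c (s t) = 0.
  apply: affv; first by rewrite -[RHS]w0 [RHS](partition_big s predT).
  rewrite -[RHS]wx0 [RHS](partition_big s predT) //=; apply: eq_bigr => a _.
  rewrite scaler_suml; apply: eq_bigr => u /eqP <-.
  by have [->|/sE ->] := eqVneq (w u) 0; rewrite ?scale0r.
move: c0; rewrite /c (bigD1 t) //= big1 ?addr0 => [/eqP|u /andP [/eqP su ut]].
  by rewrite (negbTE wt).
apply/eqP; apply: contraNT ut => wu; apply/eqP/injx.
by rewrite -(sE u wu) su sE.
Qed.

End Simplices.

Section TypeArrangement.
Variables (R : realType) (d n : nat) (A : 'M[option R]_(d, n)).
Variables (src dst : 'I_n -> 'I_d).
Hypothesis GE : forall k, col_support A k = [set src k; dst k].
Hypothesis loopless : forall k, src k != dst k.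

Definition apex i k : R := odflt 0 (A i k).
Definition offset k : R := apex (src k) k - apex (dst k) k.

Local Notation gap := (gap src dst offset).
Local Notation sign_of := (sign_of src dst offset).

Lemma finite_entry i k : isSome (A i k) = (i == src k) || (i == dst k).
Proof. by have /setP/(_ i) := GE k; rewrite !inE. Qed.

Lemma fine_typeE p i k : fine_type A p i k =
  ((i == src k) && (0 <= gap p k)) || ((i == dst k) && (gap p k <= 0)).
Proof.
have sE : A (src k) k = Some (apex (src k) k).
  by have := finite_entry (src k) k; rewrite eqxx /apex; case: (A _ _).
have dE : A (dst k) k = Some (apex (dst k) k).
  by have := finite_entry (dst k) k; rewrite eqxx orbT /apex; case: (A _ _).
have nE j : j != src k -> j != dst k -> A j k = None.
  by move=> js jd; have := finite_entry j k; rewrite (negbTE js) (negbTE jd); case: (A _ _).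
rewrite mxE finite_entry; have [->|is_] := eqVneq i (src k) => /=.
  rewrite (negbTE (loopless k)) orbF /closed_sector sE.
  apply/forallP/idP => [/(_ (dst k))|g j].
    by rewrite dE /gap /offset; lra.
  have [->|js] := eqVneq j (src k); first by rewrite sE.
  have [->|jd] := eqVneq j (dst k); first by rewrite dE; move: g; rewrite /gap /offset; lra.
  by rewrite nE.
have [->|//] := eqVneq i (dst k).
rewrite /closed_sector dE /=; apply/forallP/idP => [/(_ (src k))|g j].
  by rewrite sE /gap /offset; lra.
have [->|js] := eqVneq j (src k); first by rewrite sE; move: g; rewrite /gap /offset; lra.
have [->|jd] := eqVneq j (dst k); first by rewrite dE.
by rewrite nE.
Qed.

Lemma root_point_inj : injective (@root_point R d n).
Proof.
move=> [i k] [j l] /eq_row_mx [/matrixP/(_ 0 j) + /oppr_inj/matrixP/(_ 0 l)].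
rewrite !mxE !eqxx /= => /eqP + /eqP.
by rewrite !eqr_nat !eqb1 => /eqP -> /eqP ->.
Qed.

(** Its value at a root point counts the indices shared with e, so e is the only
    root point where it attains 2. *)
Definition root_normal (e : 'I_d * 'I_n) : 'cV[R]_(d + n) :=
  col_mx (delta_mx e.1 0) (- delta_mx e.2 0).

Lemma root_normalE (e e' : 'I_d * 'I_n) :
  (root_point R e *m root_normal e') 0 0 = (e.1 == e'.1)%:R + (e.2 == e'.2)%:R.
Proof.
rewrite mul_row_col mulNmx mulmxN opprK !mul_delta_mx_cond !mxE.
by rewrite mulrb mulrb; case: eqP; case: eqP; rewrite !mxE.
Qed.

(** Together with - p as the first block, this makes a functional that is
    nonnegative on the lifted points and zero at those in the type of p. *)
Definition floor_at (p : 'rV[R]_d) k : R :=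
  Num.min (apex (src k) k - p 0 (src k)) (apex (dst k) k - p 0 (dst k)).

Definition type_normal p : 'cV[R]_(d + n + 1) :=
  col_mx (col_mx (- p^T) (\col_k floor_at p k)) 1%:M.

Lemma type_normalE p e : (lifted_point A e *m type_normal p) 0 0 =
  apex e.1 e.2 - p 0 e.1 - floor_at p e.2.
Proof.
rewrite /lifted_point /root_point !mul_row_col mulmxN mulNmx -!rowE mulmx1.
by rewrite !mxE /= mulr1n /apex; lra.
Qed.

Lemma type_normal_ge0 p e : isSome (A e.1 e.2) ->
  0 <= (lifted_point A e *m type_normal p) 0 0.
Proof.
rewrite finite_entry type_normalE subr_ge0 /floor_at ge_min.
by move=> /orP [] /eqP ->; rewrite lexx ?orbT.
Qed.

Lemma type_normal_eq0 p i k : fine_type A p i k ->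
  (lifted_point A (i, k) *m type_normal p) 0 0 = 0.
Proof.
rewrite fine_typeE type_normalE /floor_at /gap /offset /=.
move=> /orP [] /andP [/eqP -> g].
  by rewrite (min_idPl _) ?subrr //; lra.
by rewrite (min_idPr _) ?subrr //; lra.
Qed.

Lemma cell_fine_type p i k : fine_type A p i k ->
  regular_cell A (type_normal p) (root_point R (i, k)).
Proof.
move=> Tik; exists (lifted_point A (i, k)); last by rewrite row_mxKl.
split.
  apply: conv_vertex; rewrite !inE /=.
  by move: Tik; rewrite mxE => /andP [].
move=> y [w [w0 wA _ ->]]; rewrite type_normal_eq0 // mulmx_suml summxE.
apply: sumr_ge0 => e _; rewrite -scalemxAl mxE.
have [eA|/wA ->] := boolP (e \in finite_entries A); last by rewrite mul0r.
by rewrite mulr_ge0 // type_normal_ge0 //; move: eA; rewrite inE.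
Qed.

Lemma cell_conv f x : regular_cell A f x ->
  exists2 w : 'I_d * 'I_n -> R, (forall e, 0 <= w e) /\ \sum_e w e = 1
    & x = \sum_e w e *: root_point R e.
Proof.
move=> [z [[w [w0 _ w1 ->]] _] ->]; exists w => //.
rewrite raddf_sum; apply: eq_bigr => e _.
rewrite /= /lifted_point scale_row_mx row_mxKl //.
Qed.

(** All root points in a cell are exposed in it. *)
Lemma cell_root_normal f x e : regular_cell A f x ->
  (x *m root_normal e) 0 0 <= (root_point R e *m root_normal e) 0 0 /\
  ((x *m root_normal e) 0 0 = (root_point R e *m root_normal e) 0 0 ->
   x = root_point R e).
Proof.
move=> /cell_conv [w [w0 w1] ->].
have slack_ge0 e' :
    0 <= w e' * (2 - (root_point R e' *m root_normal e) 0 0).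
  rewrite mulr_ge0 // root_normalE.
  by do 2 case: (_ == _) => /=; lra.
have slackE : (root_point R e *m root_normal e) 0 0 -
    ((\sum_e' w e' *: root_point R e') *m root_normal e) 0 0 =
    \sum_e' w e' * (2 - (root_point R e' *m root_normal e) 0 0).
  under [RHS]eq_bigr do rewrite mulrBr.
  rewrite sumrB -mulr_suml w1 mul1r {1}root_normalE !eqxx; congr (_ - _).
  rewrite mulmx_suml summxE; apply: eq_bigr => e' _.
  by rewrite -scalemxAl mxE.
split; first by rewrite -subr_ge0 slackE sumr_ge0.
move=> E; have s0 := psumr_eq0P (P := xpredT) (fun e' _ => slack_ge0 e').
have {}s0 e' : e' != e -> w e' = 0.
  have : w e' * (2 - (root_point R e' *m root_normal e) 0 0) = 0.
    by apply: s0 => //; rewrite -slackE E subrr.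
  move=> /eqP; rewrite mulf_eq0 => /orP [/eqP //|].
  rewrite root_normalE -pair_eqE /pair_eq /=.
  by case: (e'.1 == e.1); case: (e'.2 == e.2) => //= /eqP h _; exfalso; move: h; lra.
rewrite (bigD1 e) //= big1 ?addr0 => [|e' /s0 ->]; last by rewrite scale0r.
by move: w1; rewrite (bigD1 e) //= big1 ?addr0 => [->|e' /s0 //]; rewrite scale1r.
Qed.

Hypothesis genA : sufficiently_generic A.

(** The lower face of [type_normal p] contains both root points of each
    hyperplane through p.  Weighting them by a dependency of the incidence
    vectors gives an affine dependency of vertices of a simplex: the components
    e_i cancel by the dependency, and the two points of one column cancel in the
    other components. *)
Lemma generic_acyclic p : acyclic (col_support A) (zeros (sign_of p)).
Proof.
rewrite -[acyclic _ _]negbK; apply/negP => cyc.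
have [w [[k wk] wz wd]] := cycle_dependency GE loopless R cyc.
have nf : 0 < type_normal p (rshift (d + n) 0) 0.
  by rewrite /type_normal col_mxEd mxE eqxx ltr01.
pose c (e : 'I_d * 'I_n) := w e.2 * incidence src dst R e.2 e.1.
have cz e : c e != 0 -> fine_type A p e.1 e.2.
  rewrite mulf_eq0 negb_or => /andP [/wz]; rewrite inE sign_of_eq0 => /eqP g.
  rewrite fine_typeE g lexx !andbT /incidence !(eq_sym e.1).
  by do 2 case: (_ == e.1) => //=; rewrite subrr eqxx.
have inc0 l : \sum_i incidence src dst R l i = 0.
  rewrite -[RHS](subrr (1 : R)) -[RHS](incidence_sum src dst l (fun=> 1 : R)).
  by apply: eq_bigr => i _; rewrite mulr1.
have c0 := simplex_exposed_independent (w := c) (f := root_normal)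
  (genA nf) root_point_inj.
have {c0} : forall e, c e = 0.
  apply: c0 => [e /cz Te||].
  - split=> [|z /cell_root_normal H|z /cell_root_normal H].
    + by have := cell_fine_type Te; rewrite -surjective_pairing.
    + exact: (H e).1.
    + exact: (H e).2.
  - rewrite -(pair_bigA _ (fun i l => c (i, l))) exchange_big /=.
    by rewrite big1 // => l _; rewrite /c /= -mulr_sumr inc0 mulr0.
  rewrite -(pair_bigA _ (fun i l => c (i, l) *: root_point R (i, l))) /=.
  under eq_bigr => i _.
    under eq_bigr => l _ do rewrite /root_point scale_row_mx.
    over.
  apply/rowP => j; rewrite mxE summxE.
  case: (split_ordP j) => [i ->|l ->].
    rewrite (bigD1 i) //= [X in _ + X]big1 ?addr0 => [|i' /negbTE ii']; last first.
      rewrite summxE big1 // => l _; rewrite row_mxEl !mxE eqxx /=.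
      by rewrite eq_sym ii' mulr0.
    rewrite summxE -[RHS](wd i); apply: eq_bigr => l _.
    by rewrite row_mxEl !mxE !eqxx mulr1.
  under eq_bigr do rewrite summxE; rewrite exchange_big /= big1 // => m _.
  under eq_bigr do rewrite row_mxEr !mxE eqxx /=.
  by rewrite -mulr_suml /c /= -mulr_sumr inc0 mulr0 mul0r.
move=> /(_ (src k, k)) /eqP; rewrite mulf_eq0 (negbTE wk) /incidence eqxx.
by rewrite /= [dst k == _]eq_sym (negbTE (loopless k)) subr0 oner_eq0.
Qed.

End TypeArrangement.

(** * Fine and coarse type ideals *)

Section TypeIdeals.
Variables (K : fieldType) (R : realType) (d n : nat) (A : 'M[option R]_(d, n)).
Variables (src dst : 'I_n -> 'I_d).
Hypothesis GE : forall k, col_support A k = [set src k; dst k].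
Hypothesis loopless : forall k, src k != dst k.
Hypothesis genA : sufficiently_generic A.
Hypothesis connA : connected_graph (col_support A).

Local Notation gap := (gap src dst (offset A src dst)).
Local Notation sign_of := (sign_of src dst (offset A src dst)).

(** The fine and the coarse case differ only in the variables attached to the two
    sides of an edge. *)
Lemma type_ideal_invariants N (va vb : 'I_n -> 'I_N) (row : 'I_N -> 'I_d)
    (t : 'rV[R]_d -> 'X_{1..N}) :
  (forall k, row (va k) = src k) -> (forall k, row (vb k) = dst k) ->
  (forall p, t p = label va vb (enum 'I_n) (sign_of p)) ->
  number_of_minimal_generators
    (monomial_ideal (fun m => exists p, m = t p) : {mpoly K[N]} -> Prop)
    #|forests (col_support A)| /\
  highest_syzygy_rank
    (monomial_ideal (fun m => exists p, m = t p) : {mpoly K[N]} -> Prop)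
    #|spanning_trees (col_support A)|.
Proof.
move=> rowa rowb tE.
have acZ := generic_acyclic GE loopless genA.
have fam := covectors_family GE acZ rowa rowb.
have IE p : (monomial_ideal (fun m => exists p, m = t p) : {mpoly K[N]} -> Prop) p
    <-> family_ideal va vb (enum 'I_n) (covectors src dst (offset A src dst)) p.
  apply: eq_monomial_ideal => m; split=> [[q ->]|[_ /covectorsP [q <-] ->]].
    by exists (sign_of q); [exact: sign_of_covector|exact: tE].
  by exists q.
split.
  by have := family_minimal_generators fam IE; rewrite (forestsE GE acZ).
rewrite -(card_vertices GE acZ connA); apply: (family_highest_syzygy fam IE).
  by move=> u; exact: card_zeros_le.
exact: exists_vertex GE acZ connA.
Qed.

Lemma label_sign_of N (va vb : 'I_n -> 'I_N) p v :
  label va vb (enum 'I_n) (sign_of p) v =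
  (\sum_k (((0 <= gap p k)%R && (va k == v)) + ((gap p k <= 0)%R && (vb k == v))))%N.
Proof.
rewrite mnm_sumE big_enum /=; apply: eq_bigr => k _.
by rewrite side_labelE sign_of_ge0 sign_of_le0.
Qed.

Lemma fine_type_nat p i k : fine_type A p i k =
  (((0 <= gap p k)%R && (src k == i)) + ((gap p k <= 0)%R && (dst k == i)))%N :> nat.
Proof.
rewrite (fine_typeE GE loopless) !(eq_sym i) andbC [X in _ || X]andbC.
have [<-|] := eqVneq (src k) i; last by rewrite andbF.
by rewrite eq_sym (negbTE (loopless k)) !andbF orbF addn0.
Qed.

Lemma coarse_type_label p :
  coarse_type A p = label src dst (enum 'I_n) (sign_of p).
Proof.
apply/mnmP => i; rewrite mnmE label_sign_of; apply: eq_bigr => k _.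
exact: fine_type_nat.
Qed.

Lemma src_entry k : (src k, k) \in finite_entries A.
Proof. by rewrite inE (finite_entry GE) eqxx. Qed.

Lemma dst_entry k : (dst k, k) \in finite_entries A.
Proof. by rewrite inE (finite_entry GE) eqxx orbT. Qed.

Definition src_var k : 'I_#|finite_entries A| :=
  enum_rank_in (src_entry k) (src k, k).

Definition dst_var k : 'I_#|finite_entries A| :=
  enum_rank_in (dst_entry k) (dst k, k).

Lemma src_var_val k : enum_val (src_var k) = (src k, k).
Proof. by rewrite enum_rankK_in ?src_entry. Qed.

Lemma dst_var_val k : enum_val (dst_var k) = (dst k, k).
Proof. by rewrite enum_rankK_in ?dst_entry. Qed.

Lemma fine_type_label p :
  fine_type_mnm A p = label src_var dst_var (enum 'I_n) (sign_of p).
Proof.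
apply/mnmP => v; rewrite mnmE label_sign_of fine_type_nat.
rewrite (bigD1 (enum_val v).2) //= big1 ?addn0 => [|k kv].
  congr ((_ && _) + (_ && _))%N; rewrite -(inj_eq enum_val_inj).
    by rewrite src_var_val -pair_eqE /pair_eq /= eqxx andbT.
  by rewrite dst_var_val -pair_eqE /pair_eq /= eqxx andbT.
rewrite -!(inj_eq enum_val_inj) src_var_val dst_var_val -!pair_eqE /pair_eq /=.
by rewrite (negbTE kv) !andbF.
Qed.

End TypeIdeals.

Theorem corollary4p21 (K : fieldType) (R : realType) (d n : nat)
    (A : 'M[option R]_(d, n))
    (tropA : tropical_matrix A)
    (genA : sufficiently_generic A)
    (graphicA : graphic A)
    (connA : connected_graph (col_support A)) :
  [/\ number_of_minimal_generators (fine_type_ideal K A)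
        #|forests (col_support A)|,
      number_of_minimal_generators (coarse_type_ideal K A)
        #|forests (col_support A)|,
      highest_syzygy_rank (fine_type_ideal K A)
        #|spanning_trees (col_support A)|
    & highest_syzygy_rank (coarse_type_ideal K A)
        #|spanning_trees (col_support A)|].
Proof.
have /fin_all_exists [e eE] : forall k, exists e : 'I_d * 'I_d,
    e.1 != e.2 /\ col_support A k = [set e.1; e.2].
  move=> k; have /eqP/cards2P [i [j [ij E]]] := graphicA k.
  by exists (i, j).
pose src k := (e k).1; pose dst k := (e k).2.
have loopless k : src k != dst k by case: (eE k).
have GE k : col_support A k = [set src k; dst k] by case: (eE k).
have [fgen fsyz] := type_ideal_invariants K GE loopless genA connA
  (row := fun v => (enum_val v).1)
  (fun k => congr1 fst (src_var_val GE k)) (fun k => congr1 fst (dst_var_val GE k))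
  (fine_type_label GE loopless).
have [cgen csyz] := type_ideal_invariants K GE loopless genA connA
  (row := id) (fun=> erefl) (fun=> erefl) (coarse_type_label GE loopless).
by split.
Qed.
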